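(* Let $I\subset \mathbb{C}[x_1,\dots,x_m]$ and $J\subset \mathbb{C}[y_1,\dots,y_n]$ be non-zero ideals, let $f_1,\dots,f_{r_1}$ be non-zero generators of $I$ and $g_1,\dots,g_{r_2}$ non-zero generators of $J$, and let $b_{I,J}(s)$ be the product-type weak Bernstein-Sato polynomial defined from these generators. Then $$b_{I,J}(s)=b_I(s)\,b_J(s),$$ where $b_I$ and $b_J$ are the Bernstein-Sato polynomials of $I$ and $J$.
   Context: Let $X=\mathbb{C}^m$, $Y=\mathbb{C}^n$, $\mathcal{O}_X=\mathbb{C}[x_1,\dots,x_m]$, $\mathcal{O}_Y=\mathbb{C}[y_1,\dots,y_n]$, $\mathcal{O}_{X\times Y}=\mathcal{O}_X\otimes_{\mathbb{C}}\mathcal{O}_Y$, and let $\mathcal{D}_X,\mathcal{D}_Y,\mathcal{D}_{X\times Y}$ be the corresponding rings of algebraic differential operators (Weyl algebras). Write $|\bm{z}|=z_1+\cdots+z_r$ for a tuple and $\binom{z}{k}=\frac{z(z-1)\cdots(z-k+1)}{k!}$. Bernstein-Sato polynomial of an ideal. For a non-zero ideal $I\subset\mathcal{O}_X$ generated by non-zero $f_1,\dots,f_r$, with indeterminates $\bm{s}=(s_1,\dots,s_r)$, the free rank-one module $\mathcal{O}_X[\frac{1}{f_1\cdots f_r}][\bm{s}]\cdot f_1^{s_1}\cdots f_r^{s_r}$ is a left $\mathcal{D}_X[\bm{s}]$-module via $\partial_{x_k}(h\prod_i f_i^{s_i})=(\partial_{x_k}h+h\sum_i s_i\frac{\partial_{x_k}f_i}{f_i})\prod_i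 f_i^{s_i}$, and $\prod_i f_i^{s_i+\alpha_i}:=\prod_i f_i^{\alpha_i}\cdot\prod_i f_i^{s_i}$ for $\bm{\alpha}\in\mathbb{Z}^r$. Then $b_I(s)\in\mathbb{C}[s]$ is the monic polynomial of smallest degree with $$b_I(|\bm{s}|)f_1^{s_1}\cdots f_r^{s_r}\in\sum_{\bm{\alpha}\in\mathbb{Z}^r,|\bm{\alpha}|=1}\mathcal{D}_X[\bm{s}]\cdot\Big(\prod_{\alpha_i<0}\binom{s_i}{-\alpha_i}\Big)f_1^{s_1+\alpha_1}\cdots f_r^{s_r+\alpha_r}.$$ It exists and is independent of the choice of generators. $b_J$ is defined in the same way on $Y$. Product-type weak Bernstein-Sato polynomial. Let $\bm{u}=(u_1,\dots,u_{r_1})$, $\bm{v}=(v_1,\dots,v_{r_2})$ be indeterminates and $R=\mathbb{C}[\bm{u},\bm{v}]/(|\bm{u}|-|\bm{v}|)$. The free rank-one $\mathcal{O}_{X\times Y}[\frac{1}{f_1\cdots f_{r_1}g_1\cdots g_{r_2}}]\otimes_{\mathbb{C}}R$-module on the symbol $f_1^{u_1}\cdots f_{r_1}^{u_{r_1}}g_1^{v_1}\cdots g_{r_2}^{v_{r_2}}$ is a left module over $\frac{\mathcal{D}_{X\times Y}[\bm{u},\bm{v}]}{(|\bm{u}|-|\bm{v}|)}=\mathcal{D}_{X\times Y}\otimes_{\mathbb{C}}R$ via the same differentiation rule. Then $b_{I,J}(s)\in\mathbb{C}[s]$ is the unique monic polynomial of smallest degree such that $b_{I,J}(|\bm{u}|)f_1^{u_1}\cdots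 f_{r_1}^{u_{r_1}}g_1^{v_1}\cdots g_{r_2}^{v_{r_2}}$ lies in $$\sum_{\substack{\bm{\alpha}\in\mathbb{Z}^{r_1},\ \bm{\beta}\in\mathbb{Z}^{r_2}\\|\bm{\alpha}|=|\bm{\beta}|=1}}\frac{\mathcal{D}_{X\times Y}[\bm{u},\bm{v}]}{(|\bm{u}|-|\bm{v}|)}\cdot\Big(\prod_{\alpha_i<0}\binom{u_i}{-\alpha_i}\prod_{\beta_j<0}\binom{v_j}{-\beta_j}\Big)f_1^{u_1+\alpha_1}\cdots f_{r_1}^{u_{r_1}+\alpha_{r_1}}g_1^{v_1+\beta_1}\cdots g_{r_2}^{v_{r_2}+\beta_{r_2}}.$$ *)

(* Defs.v *)
From HB Require Import structures.
From mathcomp Require Import all_boot all_order all_algebra.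
From mathcomp Require Export fraction reals complex mpoly.

Set Implicit Arguments.
Unset Strict Implicit.
Unset Printing Implicit Defensive.

Import GRing.Theory.
Local Open Scope ring_scope.

Notation "x %:F" := (@FracField.tofrac _ x) : ring_scope.

Definition generates (C : fieldType) (m r : nat)
    (f : 'I_r -> {mpoly C[m]}) (I : {mpoly C[m]} -> Prop) : Prop :=
  forall h, I h <-> exists c : 'I_r -> {mpoly C[m]}, h = \sum_i c i * f i.

(* The quotient rule, applied to the representative of x chosen by the
   quotient type; the value does not depend on that choice. *)
Definition fracderiv (C : fieldType) (m : nat) (k : 'I_m)
    (x : {fraction {mpoly C[m]}}) : {fraction {mpoly C[m]}} :=
  let q := repr x in
  ((\n_q)^`M(k) * \d_q - \n_q * (\d_q)^`M(k))%:F / (\d_q ^+ 2)%:F.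

(* An element h of fsmod C m r stands for h * f_1^{s_1} ... f_r^{s_r}, with
   s_i = 'X_i.  The localization O[1/(f_1...f_r)] is realized inside Frac(O),
   see [loc]; the submodules considered below are generated by elements of
   O[1/(f_1...f_r)][s], so they do not depend on the larger ambient module. *)
Definition fsmod (C : fieldType) (m r : nat) := {mpoly {fraction {mpoly C[m]}}[r]}.

Definition loc (C : fieldType) (m r : nat) (f : 'I_r -> {mpoly C[m]})
    (x : {fraction {mpoly C[m]}}) : Prop :=
  exists (a : {mpoly C[m]}) (k : nat), x = a%:F / ((\prod_i f i) ^+ k)%:F.

Definition fsderiv (C : fieldType) (m r : nat) (f : 'I_r -> {mpoly C[m]})
    (k : 'I_m) (h : fsmod C m r) : fsmod C m r :=
  map_mpoly (fracderiv k) h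
  + h * \sum_i (((f i)^`M(k))%:F / (f i)%:F)%:MP * 'X_i.

Definition fsderivm (C : fieldType) (m r : nat) (f : 'I_r -> {mpoly C[m]})
    (b : 'X_{1..m}) (h : fsmod C m r) : fsmod C m r :=
  foldr (fun k => iter (b k) (fsderiv f k)) h (enum 'I_m).

(* D[s] in normal form: the coefficient of 'X_[b] in P : weyl C m r is the
   coefficient in O[s] of \partial^b.  Only the action of D[s] is used, so the
   (commutative) product of the type mpoly plays no role. *)
Definition weyl (C : fieldType) (m r : nat) := {mpoly {mpoly {mpoly C[m]}[r]}[m]}.

Definition weylact (C : fieldType) (m r : nat) (f : 'I_r -> {mpoly C[m]})
    (P : weyl C m r) (h : fsmod C m r) : fsmod C m r :=
  \sum_(b <- msupp P)
     map_mpoly (@FracField.tofrac {mpoly C[m]}) P@_b * fsderivm f b h.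

Definition gbinom (A : fieldType) (r : nat) (z : {mpoly A[r]}) (k : nat) :
    {mpoly A[r]} :=
  (k`!%:R^-1 : A) *: \prod_(j < k) (z - j%:R).

(* (\prod_{a_i < 0} binom(s_i, -a_i)) f_1^{s_1 + a_1} ... f_r^{s_r + a_r};
   for a_i < 0 the natural number `|a_i| is -a_i. *)
Definition fsgen (C : fieldType) (m r : nat) (f : 'I_r -> {mpoly C[m]})
    (a : {ffun 'I_r -> int}) : fsmod C m r :=
  (\prod_(i | a i < 0) gbinom 'X_i `|a i|%N)
  * (\prod_i (f i)%:F ^ (a i))%:MP.

(* The sum over the exponents a satisfying S of D[s] . fsgen f a. *)
Definition fsspan (C : fieldType) (m r : nat) (f : 'I_r -> {mpoly C[m]})
    (S : {ffun 'I_r -> int} -> Prop) (h : fsmod C m r) : Prop :=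
  exists t : seq ({ffun 'I_r -> int} * weyl C m r),
    (forall p, p \in t -> S p.1) /\
    h = \sum_(p <- t) weylact f p.2 (fsgen f p.1).

Definition polyat (C : fieldType) (m r : nat) (b : {poly C}) (z : fsmod C m r) :
    fsmod C m r :=
  (map_poly (fun c : C => ((c%:MP : {mpoly C[m]})%:F)%:MP : fsmod C m r) b).[z].

Definition minmonic (C : fieldType) (A : {poly C} -> Prop) (b : {poly C}) : Prop :=
  [/\ b \is monic, A b &
      forall c : {poly C}, c \is monic -> A c -> (size b <= size c)%N].

(* The Bernstein-Sato polynomial of the ideal generated by f. *)
Definition isBSpoly (C : fieldType) (m r : nat) (f : 'I_r -> {mpoly C[m]})
    (b : {poly C}) : Prop :=
  minmonic
    (fun c => fsspan f (fun a => \sum_i a i = 1) (polyat c (\sum_i 'X_i))) b.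

(* O_X -> O_{X x Y} and O_Y -> O_{X x Y}: the coordinates of X x Y are those
   of X followed by those of Y. *)
Definition pullX (C : fieldType) (m n : nat) (p : {mpoly C[m]}) : {mpoly C[m + n]} :=
  p \mPo [tuple 'X_(lshift n i) | i < m].
Definition pullY (C : fieldType) (m n : nat) (p : {mpoly C[n]}) : {mpoly C[m + n]} :=
  p \mPo [tuple 'X_(rshift m j) | j < n].

Definition joinfam (C : fieldType) (m n r1 r2 : nat)
    (f : 'I_r1 -> {mpoly C[m]}) (g : 'I_r2 -> {mpoly C[n]})
    (i : 'I_(r1 + r2)) : {mpoly C[m + n]} :=
  match split i with
  | inl i1 => pullX n (f i1)
  | inr i2 => pullY m (g i2)
  end.

Definition sumu (C : fieldType) (m r1 r2 : nat) : fsmod C m (r1 + r2) :=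
  \sum_(i < r1) 'X_(lshift r2 i).
Definition sumv (C : fieldType) (m r1 r2 : nat) : fsmod C m (r1 + r2) :=
  \sum_(j < r2) 'X_(rshift r1 j).

(* Equality in O[1/(h_1...h_r)] (x) R, where R = C[u,v]/(|u|-|v|). *)
Definition eqmod_uv (C : fieldType) (m r1 r2 : nat)
    (h : 'I_(r1 + r2) -> {mpoly C[m]}) (p1 p2 : fsmod C m (r1 + r2)) : Prop :=
  exists q : fsmod C m (r1 + r2),
    (forall e, loc h q@_e) /\ p1 - p2 = (sumu C m r1 r2 - sumv C m r1 r2) * q.

(* The product-type weak Bernstein-Sato polynomial.  The exponents are the
   concatenations of alpha and beta; elements and operators over R are given by
   representatives over C[u,v], on which the action is compatible with
   [eqmod_uv] because |u| - |v| is central. *)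
Definition isprodBSpoly (C : fieldType) (m n r1 r2 : nat)
    (f : 'I_r1 -> {mpoly C[m]}) (g : 'I_r2 -> {mpoly C[n]}) (b : {poly C}) : Prop :=
  minmonic
    (fun c => exists p : fsmod C (m + n) (r1 + r2),
       fsspan (joinfam f g)
         (fun a => \sum_(i < r1) a (lshift r2 i) = 1 /\
                   \sum_(j < r2) a (rshift r1 j) = 1) p /\
       eqmod_uv (joinfam f g) (polyat c (sumu C (m + n) r1 r2)) p) b.

(* Main.v *)
From HB Require Import structures.
Require Import Defs.
From mathcomp Require Import all_boot all_order all_algebra.
From mathcomp Require Import ring zify.
From mathcomp Require ssrcomplements.
Import GRing.Theory.
Local Open Scope ring_scope.

(* Write M_f for O[1/f_1...f_r][s] f^s and N_f for the submodule of the
   definition of b_I, both regarded as modules over A = C[t] with t = |s|; the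
   module of the product is M_f (x)_A M_g, and its submodule is the image of
   N_f (x) N_g. As |s| is one of the variables after a linear change of
   coordinates, M_f is free over A, so finitely generated submodules of N_f are
   free and b_I(t) f^s is a primitive element of them by minimality of b_I.
   Hence there is an A-linear functional phi on M_f with values in Frac(A) that
   is integral on the finitely many elements of N_f under consideration and has
   phi(f^s) = 1 / b_I. Similarly psi(g^s) = 1 / b_J. If c(t) f^u g^v lies in the
   image of N_f (x) N_g, then applying phi (x) psi yields c / (b_I b_J) in A.
   The converse is clear. *)

Set Implicit Arguments.
Unset Strict Implicit.
Unset Printing Implicit Defensive.

(** * Fraction fields *)

(** A finite span need not be saturated in the ambient module, so a functional that is integral on
    the span extends to the whole module only with denominators; hence the values in the fraction
    field of C[t]. Freeness enters through one consequence, obtained from Bezout relations without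
    choosing a basis: a vector v of a finite span is d z, with z in the span, and some functional
    integral on the span has value d at v. For v = b_I(t) f^s, the quotient b_I / d satisfies the
    defining condition too, which forces d to be a non-zero constant.

    Coordinates over C[t] are available for polynomials in x and s, whereas the submodules lie in a
    localization. As only finitely many elements occur, all of them are multiplied by one power (f_1
    ... f_r)^K and the functionals are evaluated on numerators. The relation |u| = |v| is not
    divided out: the product of the functionals is defined on C[x,y][u,v] through monomials and is
    shown to vanish on the multiples of |u| - |v|. *)

Lemma subf_div (K : fieldType) (a b c d : K) : b != 0 -> d != 0 ->
  a / b - c / d = (a * d - c * b) / (b * d).
Proof. by move=> b0 d0; rewrite -mulNr addf_div // mulNr. Qed.

Section Fractions.

Variable R : idomainType.

Lemma tofrac_inj : injective (@FracField.tofrac R).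
Proof. by move=> x y /eqP; rewrite tofrac_eq => /eqP. Qed.

Lemma frac_reprE (x : {fraction R}) :
  x = (\n_(repr x))%:F / (\d_(repr x))%:F.
Proof.
rewrite -{1}[x]reprK; move: (repr x) => y.
have d0 : (\d_y)%:F != 0 :> {fraction R} by rewrite tofrac_eq0 denom_ratioP.
apply: (mulIf d0); rewrite mulfVK //; apply/esym.
unlock FracField.tofrac; rewrite -[RHS]FracField.pi_mul /FracField.mulf.
apply/eqmodP; rewrite /= FracField.equivfE.
rewrite !numden_Ratio ?mulf_neq0 ?oner_neq0 ?denom_ratioP //.
by rewrite mulr1 mul1r mulrC.
Qed.

Lemma fracP (x : {fraction R}) :
  exists a b : R, b != 0 /\ x = a%:F / b%:F.
Proof.
exists \n_(repr x), \d_(repr x).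
by rewrite denom_ratioP -frac_reprE.
Qed.

Lemma frac_eq (a b c d : R) : b != 0 -> d != 0 ->
  a%:F / b%:F = c%:F / d%:F -> a * d = c * b.
Proof.
move=> b0 d0 /eqP; rewrite eqr_div ?tofrac_eq0 //.
by rewrite -!tofracM tofrac_eq => /eqP.
Qed.

End Fractions.

Section FractionMap.

Variables (R S : idomainType) (phi : {rmorphism R -> S}).

(** The proof of injectivity is an argument so that the morphism instances below can recover it from
    the term. *)
Definition fracmap of injective phi := fun x : {fraction R} =>
  (phi \n_(repr x))%:F / (phi \d_(repr x))%:F.

Hypothesis phi_inj : injective phi.

Let phi_neq0 (a : R) : a != 0 -> (phi a)%:F != 0.
Proof. by move=> a0; rewrite tofrac_eq0 -(rmorph0 phi) (inj_eq phi_inj). Qed.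

Lemma fracmap_div (a b : R) : b != 0 ->
  fracmap phi_inj (a%:F / b%:F) = (phi a)%:F / (phi b)%:F.
Proof.
move=> b0; rewrite /fracmap; set x := a%:F / b%:F.
have d0 := denom_ratioP (repr x).
apply/eqP; rewrite eqr_div ?phi_neq0 // -!tofracM tofrac_eq -!rmorphM.
by apply/eqP; congr (phi _); apply: frac_eq => //; rewrite -frac_reprE.
Qed.

Fact fracmap_is_zmod_morphism : zmod_morphism (fracmap phi_inj).
Proof.
move=> x y; have [a [b [b0 ->]]] := fracP x; have [c [d [d0 ->]]] := fracP y.
have -> : a%:F / b%:F - c%:F / d%:F = (a * d - c * b)%:F / (b * d)%:F.
  by rewrite subf_div ?tofrac_eq0 // -!tofracM -tofracB.
rewrite !fracmap_div ?mulf_neq0 // subf_div ?phi_neq0 //.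
by rewrite -!tofracM -tofracB -!rmorphM -rmorphB.
Qed.

HB.instance Definition _ := GRing.isZmodMorphism.Build _ _ (fracmap phi_inj)
  fracmap_is_zmod_morphism.

Lemma fracmap_tofrac (a : R) : fracmap phi_inj a%:F = (phi a)%:F.
Proof.
by rewrite -[a%:F]divr1 -tofrac1 fracmap_div ?oner_neq0 // rmorph1 divr1.
Qed.

Fact fracmap_is_monoid_morphism : monoid_morphism (fracmap phi_inj).
Proof.
split=> [|x y]; first by rewrite -tofrac1 fracmap_tofrac rmorph1.
have [a [b [b0 ->]]] := fracP x; have [c [d [d0 ->]]] := fracP y.
rewrite mulf_div -!tofracM !fracmap_div ?mulf_neq0 //.
by rewrite mulf_div -!tofracM -!rmorphM.
Qed.

HB.instance Definition _ := GRing.isMonoidMorphism.Build _ _ (fracmap phi_inj)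
  fracmap_is_monoid_morphism.

End FractionMap.

Section FractionDerivation.

Variables (C : fieldType) (m : nat) (k : 'I_m).
Implicit Types a b : {mpoly C[m]}.

(** The quotient rule gives the same value on every representative, so the one chosen by [repr] can
    be replaced by a / b. *)
Lemma fracderiv_div a b : b != 0 ->
  fracderiv k (a%:F / b%:F) = (a^`M(k) * b - a * b^`M(k))%:F / (b ^+ 2)%:F.
Proof.
move=> b0; rewrite /fracderiv; set x := a%:F / b%:F.
have d0 := denom_ratioP (repr x).
have : a * \d_(repr x) = \n_(repr x) * b.
  by apply: frac_eq => //; rewrite -frac_reprE.
move: \n_(repr x) \d_(repr x) d0 => c d d0 e.
apply/eqP; rewrite eqr_div ?tofrac_eq0 ?expf_neq0 // -!tofracM tofrac_eq.
apply/eqP; have := congr1 (mderiv k) e; rewrite !mderivM => e'.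
apply/eqP; rewrite -subr_eq0; apply/eqP.
(* The cross-multiplied difference is a combination of [a * d - c * b] and of its derivative, both
   of which vanish. *)
transitivity (b * d * (c^`M(k) * b + c * b^`M(k) - (a^`M(k) * d + a * d^`M(k)))
   + (b^`M(k) * d + b * d^`M(k)) * (a * d - c * b)); first by ring.
by rewrite -e' e !subrr !mulr0 addr0.
Qed.

Fact fracderiv_is_zmod_morphism : zmod_morphism (@fracderiv C m k).
Proof.
move=> x y; have [a [b [b0 ->]]] := fracP x; have [c [d [d0 ->]]] := fracP y.
have -> : a%:F / b%:F - c%:F / d%:F = (a * d - c * b)%:F / (b * d)%:F.
  by rewrite subf_div ?tofrac_eq0 // -!tofracM -tofracB.
rewrite !fracderiv_div ?mulf_neq0 //.
rewrite subf_div ?tofrac_eq0 ?expf_neq0 // -!tofracM -tofracB.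
congr (_%:F / _%:F); last by ring.
by rewrite mderivB !mderivM; ring.
Qed.

HB.instance Definition _ := GRing.isZmodMorphism.Build _ _ (@fracderiv C m k)
  fracderiv_is_zmod_morphism.

Lemma fracderivM (x y : {fraction {mpoly C[m]}}) :
  fracderiv k (x * y) = fracderiv k x * y + x * fracderiv k y.
Proof.
have [a [b [b0 ->]]] := fracP x; have [c [d [d0 ->]]] := fracP y.
rewrite mulf_div -!tofracM !fracderiv_div ?mulf_neq0 //.
rewrite !mulf_div -!tofracM addf_div ?tofrac_eq0 ?mulf_neq0 ?expf_neq0 //.
rewrite -!tofracM -tofracD.
apply/eqP; rewrite eqr_div ?tofrac_eq0 ?mulf_neq0 ?expf_neq0 //.
by rewrite -!tofracM tofrac_eq !mderivM; apply/eqP; ring.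
Qed.

Lemma fracderiv_tofrac a : fracderiv k a%:F = (a^`M(k))%:F.
Proof.
rewrite -[a%:F]divr1 -tofrac1 fracderiv_div ?oner_neq0 //.
by rewrite -mpolyC1 mderivC mulr0 subr0 mpolyC1 expr1n mulr1 tofrac1 divr1.
Qed.

End FractionDerivation.

(** * Renaming the variables of a polynomial *)

Section Polynomials.

Lemma mpoly_rmorph_eq (n : nat) (R : nzRingType) (S : nzRingType)
    (p1 p2 : {rmorphism {mpoly R[n]} -> S}) :
  (forall c, p1 c%:MP = p2 c%:MP) -> (forall i, p1 'X_i = p2 'X_i) ->
  p1 =1 p2.
Proof.
move=> eC eX p; rewrite [p]mpolyE !rmorph_sum; apply: eq_bigr => m _.
rewrite -mul_mpolyC !rmorphM eC; congr (_ * _).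
rewrite mpolyXE_id !rmorph_prod; apply: eq_bigr => i _.
by rewrite !rmorphXn eX.
Qed.

(** Applied to the difference of two derivations along the same map, this reduces their equality to
    constants and variables. *)
Lemma mpoly_derivation_eq0 (n : nat) (R : nzRingType) (S : nzRingType)
    (phi : {mpoly R[n]} -> S) (d : {additive {mpoly R[n]} -> S}) :
  (forall p q, d (p * q) = d p * phi q + phi p * d q) ->
  (forall c, d c%:MP = 0) -> (forall i, d 'X_i = 0) -> d =1 (fun=> 0).
Proof.
move=> dM dC dX p; rewrite [p]mpolyE raddf_sum big1 // => m _.
have dM0 q1 q2 : d q1 = 0 -> d q2 = 0 -> d (q1 * q2) = 0.
  by move=> e1 e2; rewrite dM e1 e2 mul0r mulr0 addr0.
have d1 : d 1 = 0 by rewrite -mpolyC1 dC.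
rewrite -mul_mpolyC mpolyXE_id; apply: (dM0) => //.
apply: (big_ind (fun q : {mpoly R[n]} => d q = 0) d1 dM0) => i _.
by elim: (m i) => [|k IH]; rewrite ?expr0 // exprS; apply: (dM0).
Qed.

Lemma map_mpolyZX (n : nat) (R S : nzRingType) (f : {additive R -> S})
    (c : R) (m : 'X_{1..n}) : map_mpoly f (c *: 'X_[m]) = f c *: 'X_[m].
Proof.
apply/mpolyP => k; rewrite mcoeff_map_mpoly !mcoeffZ !mcoeffX.
by case: eqP => _; rewrite ?mulr1 // !mulr0 raddf0.
Qed.

Lemma map_mpoly_inj (n : nat) (R S : nzRingType) (f : {additive R -> S}) :
  injective f -> injective (@map_mpoly n R S f).
Proof.
move=> f_inj p q e; apply/mpolyP => k; apply: f_inj.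
by have := congr1 (mcoeff k) e; rewrite !mcoeff_map_mpoly.
Qed.

Lemma map_mpoly_commute (n : nat) (R S : nzRingType) (f : {additive R -> S})
    (d : {additive R -> R}) (d' : {additive S -> S}) (p : {mpoly R[n]}) :
  (forall c, d' (f c) = f (d c)) ->
  map_mpoly d' (map_mpoly f p) = map_mpoly f (map_mpoly d p).
Proof. by move=> e; apply/mpolyP => k; rewrite !mcoeff_map_mpoly; apply: e. Qed.

Lemma map_mpolyM_derivation (n : nat) (R : nzRingType) (d : {additive R -> R}) :
  (forall a b, d (a * b) = d a * b + a * d b) ->
  forall p q : {mpoly R[n]},
    map_mpoly d (p * q) = map_mpoly d p * q + p * map_mpoly d q.
Proof.
move=> dM p q; apply/mpolyP => k.
rewrite mcoeff_map_mpoly mcoeffD !mcoeffM raddf_sum -big_split /=.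
by apply: eq_bigr => i _; rewrite dM !mcoeff_map_mpoly.
Qed.

End Polynomials.

Section Rename.

Variables (n N : nat) (kap : 'I_n -> 'I_N).

(** For [kap] a left or right shift this is convertible to [pullX] or [pullY]. *)
Definition mren (R : nzRingType) (p : {mpoly R[n]}) : {mpoly R[N]} :=
  p \mPo [tuple 'X_(kap i) | i < n].

HB.instance Definition _ (R : nzRingType) := 
  GRing.Additive.copy (@mren R)
    (comp_mpoly [tuple 'X_(kap i) | i < n] : {mpoly R[n]} -> {mpoly R[N]}).
HB.instance Definition _ (R : comNzRingType) :=
  GRing.RMorphism.copy (@mren R)
    (comp_mpoly [tuple 'X_(kap i) | i < n] : {mpoly R[n]} -> {mpoly R[N]}).

Lemma mrenC (R : nzRingType) (c : R) : mren c%:MP = c%:MP.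
Proof. exact: comp_mpolyC. Qed.

Lemma mrenX (R : nzRingType) (i : 'I_n) : mren 'X_i = 'X_(kap i) :> {mpoly R[N]}.
Proof. by rewrite /mren comp_mpolyXU -tnth_nth tnth_mktuple. Qed.

Definition mnmren (m : 'X_{1..n}) : 'X_{1..N} :=
  (\sum_(i < n) U_(kap i) *+ m i)%MM.

Lemma mrenZX (R : nzRingType) (c : R) m : mren (c *: 'X_[m]) = c *: 'X_[mnmren m].
Proof.
rewrite /mren comp_mpolyZ comp_mpolyX; congr (_ *: _).
rewrite /mnmren -mprodXnE; apply: eq_bigr => i _.
by rewrite tnth_mktuple.
Qed.

Lemma map_mpoly_mren (R S : nzRingType) (f : {additive R -> S})
    (p : {mpoly R[n]}) : map_mpoly f (mren p) = mren (map_mpoly f p).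
Proof.
elim/mpolyind: p => [|c m p _ _ IH]; first by rewrite !raddf0.
by rewrite !raddfD /= IH map_mpolyZX !mrenZX map_mpolyZX.
Qed.

Hypothesis kap_inj : injective kap.

Lemma mren_inj (R : comNzRingType) : injective (@mren R).
Proof.
(* A left inverse of the renaming: variables outside the image of [kap] are sent to 0. *)
pose back := [tuple (if [pick i | kap i == j] is Some i then 'X_i
                     else 0 : {mpoly R[n]}) | j < N].
apply: (can_inj (g := comp_mpoly back)).
apply: (mpoly_rmorph_eq (p1 := comp_mpoly back \o @mren R) (p2 := idfun)) => [c|i] /=.
  by rewrite mrenC comp_mpolyC.
rewrite mrenX comp_mpolyXU -tnth_nth tnth_mktuple.
case: pickP => [i' /eqP/kap_inj -> //|/(_ i)]; by rewrite eqxx.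
Qed.

Lemma mderivXU (R : nzRingType) q (i k : 'I_q) :
  ('X_i : {mpoly R[q]})^`M(k) = (i == k)%:R.
Proof.
rewrite mderivX mnm1E; case: eqP => [->|_]; last by rewrite scale0r.
by rewrite scale1r -{1}[U_(k)%MM]addm0 addmC addmK mpolyX0.
Qed.

Lemma mderiv_mren (R : comNzRingType) (p : {mpoly R[n]}) k :
  (mren p)^`M(kap k) = mren p^`M(k).
Proof.
pose d : {additive {mpoly R[n]} -> {mpoly R[N]}} :=
  (mderiv (kap k) \o @mren R) \- (@mren R \o mderiv k).
apply/eqP; rewrite -subr_eq0; apply/eqP.
apply: (mpoly_derivation_eq0 (phi := @mren R) (d := d)) => [q1 q2|c|i] /=.
- by rewrite rmorphM !mderivM rmorphD !rmorphM /=; ring.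
- by rewrite mrenC !mderivC raddf0 subrr.
by rewrite mrenX !mderivXU (inj_eq kap_inj) rmorph_nat subrr.
Qed.

Lemma mderiv_mren0 (R : comNzRingType) (p : {mpoly R[n]}) j :
  (forall i, kap i != j) -> (mren p)^`M(j) = 0.
Proof.
move=> nj; pose d : {additive {mpoly R[n]} -> {mpoly R[N]}} :=
  mderiv j \o @mren R.
apply: (mpoly_derivation_eq0 (phi := @mren R) (d := d)) => [q1 q2|c|i] /=.
- by rewrite rmorphM mderivM.
- by rewrite mrenC mderivC.
by rewrite mrenX mderivXU (negPf (nj i)).
Qed.

End Rename.

Section Lift.

Variables (n N : nat) (kap : 'I_n -> 'I_N) (R S : comNzRingType).
Variable phi : {rmorphism R -> S}.

Definition mlift (p : {mpoly R[n]}) : {mpoly S[N]} := mren kap (map_mpoly phi p).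

HB.instance Definition _ := GRing.RMorphism.copy mlift
  (@mren _ _ kap S \o map_mpoly phi).

Lemma mliftC c : mlift c%:MP = (phi c)%:MP.
Proof. by rewrite /mlift map_mpolyC mrenC. Qed.

Lemma mliftZ c p : mlift (c *: p) = phi c *: mlift p.
Proof. by rewrite -!mul_mpolyC rmorphM /= mliftC. Qed.

Lemma mliftZX c (e : 'X_{1..n}) : mlift (c *: 'X_[e]) = phi c *: mren kap 'X_[e].
Proof. by rewrite mliftZ /mlift map_mpolyX. Qed.

Lemma mliftX i : mlift 'X_i = 'X_(kap i).
Proof. by rewrite /mlift map_mpolyX mrenX. Qed.

Lemma map_mpoly_mlift (d : {additive R -> R}) (d' : {additive S -> S}) p :
  (forall c, d' (phi c) = phi (d c)) ->
  map_mpoly d' (mlift p) = mlift (map_mpoly d p).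
Proof.
move=> dE; rewrite /mlift map_mpoly_mren; congr (mren _ _); apply/mpolyP => e.
by rewrite !mcoeff_map_mpoly dE.
Qed.

Lemma map_mpoly_mlift0 (d' : {additive S -> S}) p :
  (forall c, d' (phi c) = 0) -> map_mpoly d' (mlift p) = 0.
Proof.
move=> dE; rewrite /mlift map_mpoly_mren -[RHS](raddf0 (@mren _ _ kap S)).
congr (mren _ _); apply/mpolyP => e.
by rewrite !mcoeff_map_mpoly mcoeff0 dE.
Qed.

End Lift.

Lemma mlift_map_mpoly (n N : nat) (kap : 'I_n -> 'I_N)
    (R S R' S' : comNzRingType) (phi : {rmorphism R -> S})
    (psi : {rmorphism R' -> S'}) (a : {rmorphism R -> R'})
    (b : {rmorphism S -> S'}) (p : {mpoly R[n]}) :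
  (forall c, psi (a c) = b (phi c)) ->
  mlift kap psi (map_mpoly a p) = map_mpoly b (mlift kap phi p).
Proof.
move=> e; rewrite /mlift map_mpoly_mren; congr mren; apply/mpolyP => k.
by rewrite !mcoeff_map_mpoly; apply: e.
Qed.

(** * Polynomials inside fractions, and lifting both to more variables *)

Section Embedding.

Variables (C : fieldType) (m r : nat).

Definition emb : {mpoly {mpoly C[m]}[r]} -> fsmod C m r :=
  map_mpoly (@FracField.tofrac {mpoly C[m]}).

HB.instance Definition _ := GRing.RMorphism.copy emb
  (map_mpoly (@FracField.tofrac {mpoly C[m]})
   : {mpoly {mpoly C[m]}[r]} -> {mpoly {fraction {mpoly C[m]}}[r]}).

Lemma emb_inj : injective emb.
Proof. exact/map_mpoly_inj/tofrac_inj. Qed.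

Lemma embC c : emb c%:MP = c%:F%:MP.
Proof. exact: map_mpolyC. Qed.

Lemma embX k : emb 'X_[k] = 'X_[k].
Proof. exact: map_mpolyX. Qed.

Lemma embM p q : emb (p * q) = emb p * emb q.
Proof. exact: rmorphM. Qed.

Lemma mcoeff_emb p k : (emb p)@_k = (p@_k)%:F.
Proof. exact: mcoeff_map_mpoly. Qed.

End Embedding.

Section Lift.

Variables (C : fieldType) (m M r R : nat).
Variables (iota : 'I_m -> 'I_M) (kap : 'I_r -> 'I_R).
Hypothesis iota_inj : injective iota.

Definition plift : {mpoly {mpoly C[m]}[r]} -> {mpoly {mpoly C[M]}[R]} :=
  mlift kap (mren iota (R := C)).

HB.instance Definition _ := GRing.RMorphism.copy plift
  (mlift kap (mren iota (R := C))).

Definition frename : {fraction {mpoly C[m]}} -> {fraction {mpoly C[M]}} :=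
  fracmap (mren_inj iota_inj (R := C)).

HB.instance Definition _ := GRing.RMorphism.copy frename
  (fracmap (mren_inj iota_inj (R := C))).

Definition flift : fsmod C m r -> fsmod C M R := mlift kap frename.

HB.instance Definition _ := GRing.RMorphism.copy flift (mlift kap frename).

Lemma frename_div (a b : {mpoly C[m]}) : b != 0 ->
  frename (a%:F / b%:F) = (mren iota a)%:F / (mren iota b)%:F.
Proof. exact: fracmap_div. Qed.

Lemma frename_tofrac a : frename a%:F = (mren iota a)%:F.
Proof. exact: fracmap_tofrac. Qed.

Lemma flift_emb p : flift (emb p) = emb (plift p).
Proof. by apply: mlift_map_mpoly => c; apply: frename_tofrac. Qed.

Lemma fliftC c : flift c%:MP = (frename c)%:MP.
Proof. exact: mliftC. Qed.

Lemma fliftZ c p : flift (c *: p) = frename c *: flift p.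
Proof. exact: mliftZ. Qed.

Lemma fliftX i : flift 'X_i = 'X_(kap i).
Proof. exact: mliftX. Qed.

Let mren_neq0 (b : {mpoly C[m]}) : b != 0 -> mren iota b != 0.
Proof.
apply: contraNneq; rewrite -(rmorph0 (@mren _ _ iota C)).
by move/(mren_inj iota_inj) ->.
Qed.

Lemma fracderiv_frename k x :
  fracderiv (iota k) (frename x) = frename (fracderiv k x).
Proof.
have [a [b [b0 ->]]] := fracP x.
rewrite frename_div // !fracderiv_div ?mren_neq0 // frename_div ?expf_neq0 //.
rewrite !mderiv_mren //; congr (_%:F / _%:F); last by rewrite rmorphXn.
by rewrite rmorphB !rmorphM.
Qed.

Lemma fracderiv_frename0 j x :
  (forall i, iota i != j) -> fracderiv j (frename x) = 0.
Proof.
move=> nj; have [a [b [b0 ->]]] := fracP x.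
rewrite frename_div // fracderiv_div ?mren_neq0 // !mderiv_mren0 //.
by rewrite mul0r mulr0 subrr tofrac0 mul0r.
Qed.

Lemma map_fracderiv_flift k p :
  map_mpoly (fracderiv (iota k)) (flift p) = flift (map_mpoly (fracderiv k) p).
Proof. exact/map_mpoly_mlift/fracderiv_frename. Qed.

Lemma map_fracderiv_flift0 j p :
  (forall i, iota i != j) -> map_mpoly (fracderiv j) (flift p) = 0.
Proof. by move=> nj; apply: map_mpoly_mlift0 => c; apply: fracderiv_frename0. Qed.

End Lift.

(** * The action on a product *)

(** Iterated derivatives are composed in the order of [enum], so the derivatives on the product
    split into an X block applied after a Y block. *)
Lemma enum_ord_split m n :
  enum 'I_(m + n) = map (lshift n) (enum 'I_m) ++ map (@rshift m n) (enum 'I_n).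
Proof.
apply: (inj_map val_inj); rewrite map_cat.
transitivity (map val (enum 'I_m) ++ map (addn m) (map val (enum 'I_n))).
  by rewrite !val_enum_ord -iotaDl addn0 iotaD.
by rewrite -!map_comp.
Qed.

Lemma fmorph_exprz (K L : fieldType) (phi : {rmorphism K -> L}) x (z : int) :
  phi (x ^ z) = phi x ^ z.
Proof. by case: z => k; rewrite /exprz ?fmorphV rmorphXn. Qed.

Lemma foldr_iter_morph (T U I : Type) (G : T -> U) (D : I -> T -> T)
    (D' : I -> U -> U) (e e' : I -> nat) (s : seq I) x :
  (forall i, e' i = e i) -> (forall i t, D' i (G t) = G (D i t)) ->
  foldr (fun i => iter (e' i) (D' i)) (G x) s = G (foldr (fun i => iter (e i) (D i)) x s).
Proof.
move=> ee GD; elim: s => //= i s ->; rewrite ee.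
by elim: (e i) => //= k ->; rewrite GD.
Qed.

(** The 0 is the derivative of the factor in the other variables, and [t] is the sum of the
    logarithmic derivatives. *)
Lemma leibniz_left (S : comPzRingType) (dx x y t : S) :
  dx * y + x * 0 + x * y * t = (dx + x * t) * y.
Proof. by ring. Qed.

Lemma leibniz_right (S : comPzRingType) (x dy y t : S) :
  0 * y + x * dy + x * y * t = x * (dy + y * t).
Proof. by ring. Qed.

Definition lmnm p q (b : 'X_{1..p + q}) : 'X_{1..p} := [multinom b (lshift q i) | i < p].
Definition rmnm p q (b : 'X_{1..p + q}) : 'X_{1..q} := [multinom b (rshift p i) | i < q].

Definition joinmnm p q (a : 'X_{1..p}) (b : 'X_{1..q}) : 'X_{1..p + q} :=
  [multinom (match split i with inl j => a j | inr j => b j end) | i < p + q].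

Lemma lmnm_join p q (a : 'X_{1..p}) (b : 'X_{1..q}) : lmnm (joinmnm a b) = a.
Proof. by apply/mnmP => i; rewrite !mnmE (unsplitK (inl i)). Qed.

Lemma rmnm_join p q (a : 'X_{1..p}) (b : 'X_{1..q}) : rmnm (joinmnm a b) = b.
Proof. by apply/mnmP => i; rewrite !mnmE (unsplitK (inr i)). Qed.

Section LiftGenerators.

Variables (C : fieldType) (m M r R : nat).
Variables (iota : 'I_m -> 'I_M) (kap : 'I_r -> 'I_R).
Hypothesis iota_inj : injective iota.

Lemma flift_gbinomX i k :
  flift kap iota_inj (gbinom 'X_i k : fsmod C m r) = gbinom 'X_(kap i) k.
Proof.
rewrite /gbinom fliftZ fmorphV rmorph_nat rmorph_prod; congr (_ *: _).
by apply: eq_bigr => j _; rewrite rmorphB rmorph_nat; congr (_ - _); exact: fliftX.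
Qed.

(** [H] and [c'] are left general so that they can be the two halves of a joined family and of a
    joined exponent, as they appear when the products over [r1 + r2] indices are split. *)
Lemma flift_fsgen (h : 'I_r -> {mpoly C[m]}) (H : 'I_r -> {mpoly C[M]})
    (c : {ffun 'I_r -> int}) (c' : 'I_r -> int) :
  (forall i, H i = mren iota (h i)) -> c =1 c' ->
  flift kap iota_inj (fsgen h c) =
  (\prod_(i | c' i < 0) gbinom 'X_(kap i) `|c' i|%N) * (\prod_i (H i)%:F ^ c' i)%:MP.
Proof.
move=> eH ec; rewrite /fsgen rmorphM; congr (_ * _).
  rewrite rmorph_prod; apply: eq_big => i; first by rewrite ec.
  by rewrite ec => _; exact: flift_gbinomX.
rewrite [LHS]fliftC rmorph_prod; congr (_%:MP); apply: eq_bigr => i _.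
by rewrite ec eH -(frename_tofrac iota_inj) fmorph_exprz.
Qed.

End LiftGenerators.

Section Product.

Variables (C : fieldType) (m n r1 r2 : nat).
Variables (f : 'I_r1 -> {mpoly C[m]}) (g : 'I_r2 -> {mpoly C[n]}).

Definition liftX : fsmod C m r1 -> fsmod C (m + n) (r1 + r2) :=
  flift (@lshift r1 r2) (@lshift_inj m n).
Definition liftY : fsmod C n r2 -> fsmod C (m + n) (r1 + r2) :=
  flift (@rshift r1 r2) (@rshift_inj m n).

HB.instance Definition _ := GRing.RMorphism.copy liftX
  (flift (@lshift r1 r2) (@lshift_inj m n)).
HB.instance Definition _ := GRing.RMorphism.copy liftY
  (flift (@rshift r1 r2) (@rshift_inj m n)).

Definition pliftX : {mpoly {mpoly C[m]}[r1]} -> {mpoly {mpoly C[m + n]}[r1 + r2]} :=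
  plift (@lshift m n) (@lshift r1 r2).
Definition pliftY : {mpoly {mpoly C[n]}[r2]} -> {mpoly {mpoly C[m + n]}[r1 + r2]} :=
  plift (@rshift m n) (@rshift r1 r2).

HB.instance Definition _ := GRing.RMorphism.copy pliftX
  (plift (@lshift m n) (@lshift r1 r2)).
HB.instance Definition _ := GRing.RMorphism.copy pliftY
  (plift (@rshift m n) (@rshift r1 r2)).

Lemma liftX_emb p : liftX (emb p) = emb (pliftX p).
Proof. exact: flift_emb. Qed.
Lemma liftY_emb p : liftY (emb p) = emb (pliftY p).
Proof. exact: flift_emb. Qed.

Local Notation fg := (joinfam f g).

Lemma joinfam_lshift i : fg (lshift r2 i) = mren (@lshift m n) (f i).
Proof. by rewrite /joinfam (unsplitK (inl i)). Qed.
Lemma joinfam_rshift i : fg (rshift r1 i) = mren (@rshift m n) (g i).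
Proof. by rewrite /joinfam (unsplitK (inr i)). Qed.

Lemma fsderivM p q (h : 'I_q -> {mpoly C[p]}) k (a b : fsmod C p q) :
  fsderiv h k (a * b) =
  (map_mpoly (fracderiv k) a * b + a * map_mpoly (fracderiv k) b)
  + a * b * \sum_i ((h i)^`M(k)%:F / (h i)%:F)%:MP * 'X_i.
Proof. by rewrite /fsderiv (map_mpolyM_derivation (@fracderivM _ _ _)). Qed.

Lemma map_fracderiv_liftX k a :
  map_mpoly (fracderiv (lshift n k)) (liftX a) = liftX (map_mpoly (fracderiv k) a).
Proof. exact: map_fracderiv_flift. Qed.
Lemma map_fracderiv_liftY k b :
  map_mpoly (fracderiv (rshift m k)) (liftY b) = liftY (map_mpoly (fracderiv k) b).
Proof. exact: map_fracderiv_flift. Qed.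
Lemma map_fracderiv_liftX0 k a : map_mpoly (fracderiv (rshift m k)) (liftX a) = 0.
Proof. by apply: map_fracderiv_flift0 => i; rewrite eq_shift. Qed.
Lemma map_fracderiv_liftY0 k b : map_mpoly (fracderiv (lshift n k)) (liftY b) = 0.
Proof. by apply: map_fracderiv_flift0 => i; rewrite eq_shift. Qed.

Lemma liftXM a b : liftX (a * b) = liftX a * liftX b.
Proof. exact: rmorphM. Qed.
Lemma liftYM a b : liftY (a * b) = liftY a * liftY b.
Proof. exact: rmorphM. Qed.

Lemma liftXC c : liftX c%:MP = (frename (@lshift_inj m n) c)%:MP.
Proof. exact: fliftC. Qed.
Lemma liftYC c : liftY c%:MP = (frename (@rshift_inj m n) c)%:MP.
Proof. exact: fliftC. Qed.
Lemma liftXX i : liftX 'X_i = 'X_(lshift r2 i).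
Proof. exact: fliftX. Qed.
Lemma liftYX i : liftY 'X_i = 'X_(rshift r1 i).
Proof. exact: fliftX. Qed.

Let logder p q (h : 'I_q -> {mpoly C[p]}) k i : {fraction {mpoly C[p]}} :=
  (h i)^`M(k)%:F / (h i)%:F.

Lemma logder_joinXX k i :
  logder fg (lshift n k) (lshift r2 i) = frename (@lshift_inj m n) (logder f k i).
Proof.
rewrite /logder joinfam_lshift mderiv_mren; last exact: lshift_inj.
by rewrite fmorph_div; congr (_ / _); apply/esym/frename_tofrac.
Qed.

Lemma logder_joinYY k i :
  logder fg (rshift m k) (rshift r1 i) = frename (@rshift_inj m n) (logder g k i).
Proof.
rewrite /logder joinfam_rshift mderiv_mren; last exact: rshift_inj.
by rewrite fmorph_div; congr (_ / _); apply/esym/frename_tofrac.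
Qed.

Lemma logder_joinXY k i : logder fg (lshift n k) (rshift r1 i) = 0.
Proof.
rewrite /logder joinfam_rshift mderiv_mren0 => [|j]; last by rewrite eq_shift.
by rewrite tofrac0 mul0r.
Qed.

Lemma logder_joinYX k i : logder fg (rshift m k) (lshift r2 i) = 0.
Proof.
rewrite /logder joinfam_lshift mderiv_mren0 => [|j]; last by rewrite eq_shift.
by rewrite tofrac0 mul0r.
Qed.

Lemma sum_logder_joinX k :
  \sum_i (logder fg (lshift n k) i)%:MP * 'X_i =
  liftX (\sum_i (logder f k i)%:MP * 'X_i).
Proof.
rewrite big_split_ord /= [X in _ + X]big1 => [|i _]; last first.
  by rewrite logder_joinXY mpolyC0 mul0r.
rewrite addr0 rmorph_sum; apply: eq_bigr => i _.
by rewrite logder_joinXX -liftXC -liftXX -rmorphM.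
Qed.

Lemma sum_logder_joinY k :
  \sum_i (logder fg (rshift m k) i)%:MP * 'X_i =
  liftY (\sum_i (logder g k i)%:MP * 'X_i).
Proof.
rewrite big_split_ord /= [X in X + _]big1 => [|i _]; last first.
  by rewrite logder_joinYX mpolyC0 mul0r.
rewrite add0r rmorph_sum; apply: eq_bigr => i _.
by rewrite logder_joinYY -liftYC -liftYX -rmorphM.
Qed.

(** Neither the coefficients of [liftY b] nor the g_j involve x, so both terms of the
    differentiation rule see the X factor alone. *)
Lemma fsderiv_joinX k a b :
  fsderiv fg (lshift n k) (liftX a * liftY b) = liftX (fsderiv f k a) * liftY b.
Proof.
rewrite fsderivM map_fracderiv_liftX map_fracderiv_liftY0 sum_logder_joinX.
rewrite /fsderiv rmorphD rmorphM; exact: leibniz_left.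
Qed.

Lemma fsderiv_joinY k a b :
  fsderiv fg (rshift m k) (liftX a * liftY b) = liftX a * liftY (fsderiv g k b).
Proof.
rewrite fsderivM map_fracderiv_liftY map_fracderiv_liftX0 sum_logder_joinY.
rewrite /fsderiv rmorphD rmorphM; exact: leibniz_right.
Qed.

Lemma fsderivm_join b h k :
  fsderivm fg b (liftX h * liftY k) =
  liftX (fsderivm f (lmnm b) h) * liftY (fsderivm g (rmnm b) k).
Proof.
rewrite [LHS]/fsderivm enum_ord_split foldr_cat 2!foldr_map.
have eY : foldr (fun x z => iter (b (rshift m x)) (fsderiv fg (rshift m x)) z)
    (liftX h * liftY k) (enum 'I_n) = liftX h * liftY (fsderivm g (rmnm b) k).
  apply: (@foldr_iter_morph _ _ _ (fun z => liftX h * liftY z) (fsderiv g)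
    (fun x => fsderiv fg (rshift m x)) (rmnm b)) => i *; first by rewrite mnmE.
  exact: fsderiv_joinY.
have eX z : foldr (fun x z => iter (b (lshift n x)) (fsderiv fg (lshift n x)) z)
    (liftX h * liftY z) (enum 'I_m) = liftX (fsderivm f (lmnm b) h) * liftY z.
  apply: (@foldr_iter_morph _ _ _ (fun x => liftX x * liftY z) (fsderiv f)
    (fun x => fsderiv fg (lshift n x)) (lmnm b)) => i *; first by rewrite mnmE.
  exact: fsderiv_joinX.
rewrite [X in foldr _ X _]eY; exact: eX.
Qed.

Lemma fsgen_join a :
  fsgen fg a = liftX (fsgen f [ffun i => a (lshift r2 i)]) *
               liftY (fsgen g [ffun i => a (rshift r1 i)]).
Proof.
have eX := @flift_fsgen _ _ _ _ _ _ (@lshift r1 r2) (@lshift_inj m n) f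
  (fun i => fg (lshift r2 i)) [ffun i => a (lshift r2 i)] (fun i => a (lshift r2 i))
  joinfam_lshift (ffunE _).
have eY := @flift_fsgen _ _ _ _ _ _ (@rshift r1 r2) (@rshift_inj m n) g
  (fun i => fg (rshift r1 i)) [ffun i => a (rshift r1 i)] (fun i => a (rshift r1 i))
  joinfam_rshift (ffunE _).
rewrite [X in _ = X * _]eX [X in _ = _ * X]eY.
rewrite /fsgen !big_split_ord mpolyCM; exact: mulrACA.
Qed.

End Product.

(** * The submodule spanned by the generators *)

Lemma scalerMM (B : comNzRingType) (L : comAlgType B) (a b : B) (x y : L) :
  (a * b) *: (x * y) = (a *: x) * (b *: y).
Proof. by rewrite -scalerAl -scalerAr scalerA. Qed.

(** Surjectivity of the map from the tensor product of B1 and B2 to B, put as an induction principle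
    so that no tensor product has to be formed. *)
Definition tensor_generated (B1 B2 B : pzSemiRingType) (phi1 : B1 -> B) (phi2 : B2 -> B) :=
  forall Q : B -> Prop, Q 0 -> (forall x y, Q x -> Q y -> Q (x + y)) ->
  (forall a b, Q (phi1 a * phi2 b)) -> forall x, Q x.

Lemma mpolyX_split (R : comNzRingType) p q (e : 'X_{1..p + q}) :
  'X_[e] = mren (@lshift p q) 'X_[lmnm e] * mren (@rshift p q) 'X_[rmnm e]
    :> {mpoly R[p + q]}.
Proof.
rewrite mpolyXE_id big_split_ord /mren !comp_mpolyX.
by congr (_ * _); apply: eq_bigr => i _; rewrite tnth_mktuple mnmE.
Qed.

(** Monomials always factor, so the property passes from coefficients to polynomials. It is used
    twice: for C[x,y], and then for C[x,y][u,v]. *)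
Lemma mlift_tensor_generated (B1 B2 B : comNzRingType) p q
    (phi1 : {rmorphism B1 -> B}) (phi2 : {rmorphism B2 -> B}) :
  tensor_generated phi1 phi2 ->
  tensor_generated (mlift (@lshift p q) phi1) (mlift (@rshift p q) phi2).
Proof.
move=> gen Q Q0 QD QM; elim/mpolyind => // c e P _ _; apply: (QD).
move: c; apply: gen => [|x y Qx Qy|a b]; first by rewrite scale0r.
  by rewrite scalerDl; apply: QD.
rewrite mpolyX_split scalerMM -(mliftZX _ phi1) -(mliftZX _ phi2); exact: QM.
Qed.

Lemma map_mpoly_idfun (B : comNzRingType) p (x : {mpoly B[p]}) : map_mpoly idfun x = x.
Proof. by apply/mpolyP => k; rewrite mcoeff_map_mpoly. Qed.

Lemma mren_tensor_generated (B : comNzRingType) p q :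
  tensor_generated (mren (@lshift p q) (R := B)) (mren (@rshift p q) (R := B)).
Proof.
move=> Q Q0 QD QM.
apply: (@mlift_tensor_generated B B B p q idfun idfun _ Q Q0 QD) => [Q' Q'0 Q'D Q'M x|a b].
  (* The coefficients are generated trivially, since x = x * 1. *)
  by rewrite -[x]mulr1; exact: Q'M.
by rewrite /mlift !map_mpoly_idfun; exact: QM.
Qed.

Section Span.

Variables (C : fieldType) (m r : nat) (f : 'I_r -> {mpoly C[m]}).
Variable S : {ffun 'I_r -> int} -> Prop.

Lemma fsspan0 : fsspan f S 0.
Proof. by exists [::]; split=> //; rewrite big_nil. Qed.

Lemma fsspanD h k : fsspan f S h -> fsspan f S k -> fsspan f S (h + k).
Proof.
move=> [s [sS ->]] [t [tS ->]]; exists (s ++ t); split; last by rewrite big_cat.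
by move=> p; rewrite mem_cat => /orP [/sS|/tS].
Qed.

Lemma fsspan_term c b a : S a -> fsspan f S (emb c * fsderivm f b (fsgen f a)).
Proof.
move=> Sa; exists [:: (a, c *: 'X_[b] : weyl C m r)]; split.
  by move=> p; rewrite inE => /eqP ->.
rewrite big_seq1 /weylact /=.
have [->|c0] := eqVneq c 0; first by rewrite scale0r msupp0 big_nil raddf0 mul0r.
by rewrite msuppMCX // big_seq1 mcoeffZ mcoeffX eqxx mulr1.
Qed.

Lemma fsspan_ind (Q : fsmod C m r -> Prop) :
  Q 0 -> (forall h k, Q h -> Q k -> Q (h + k)) ->
  (forall c b a, S a -> Q (emb c * fsderivm f b (fsgen f a))) ->
  forall h, fsspan f S h -> Q h.
Proof.
move=> Q0 QD Qt h [s [sS ->]]; rewrite big_seq.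
apply: (big_ind Q Q0 QD) => p /sS Sp.
by apply: (big_ind Q Q0 QD) => b _; exact: Qt.
Qed.

Lemma fsspanM c h : fsspan f S h -> fsspan f S (emb c * h).
Proof.
move: h; apply: fsspan_ind => [|h k|c' b a Sa].
- by rewrite mulr0; exact: fsspan0.
- by rewrite mulrDr; exact: fsspanD.
by rewrite mulrA -rmorphM; exact: fsspan_term.
Qed.

End Span.

Section JoinSpan.

Variables (C : fieldType) (m n r1 r2 : nat).
Variables (f : 'I_r1 -> {mpoly C[m]}) (g : 'I_r2 -> {mpoly C[n]}).

Local Notation sumone := (fun a => \sum_i a i = 1).
Local Notation sumones := (fun a : {ffun 'I_(r1 + r2) -> int} =>
  \sum_(i < r1) a (lshift r2 i) = 1 /\ \sum_(j < r2) a (rshift r1 j) = 1).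
Local Notation liftX := (@liftX C m n r1 r2).
Local Notation liftY := (@liftY C m n r1 r2).

Lemma plift_tensor_generated :
  tensor_generated (@pliftX C m n r1 r2) (@pliftY C m n r1 r2).
Proof.
exact: (@mlift_tensor_generated _ _ _ r1 r2 (mren (@lshift m n) (R := C))
  (mren (@rshift m n) (R := C)) (@mren_tensor_generated C m n)).
Qed.

(** A product of two terms in normal form is again one, with joined derivative and generator
    exponents. *)
Lemma fsspan_join_mul a b : fsspan f sumone a -> fsspan g sumone b ->
  fsspan (joinfam f g) sumones (liftX a * liftY b).
Proof.
move=> fa gb; move: a fa; apply: fsspan_ind => [|h k Qh Qk|c e a Sa].
- rewrite (rmorph0 liftX) (mul0r (liftY b)); exact: fsspan0.
- rewrite (rmorphD liftX) mulrDl; exact: (fsspanD Qh Qk).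
move: b gb; apply: fsspan_ind => [|h k Qh Qk|c' e' a' Sa'].
- rewrite (rmorph0 liftY) mulr0; exact: fsspan0.
- rewrite (rmorphD liftY) mulrDr; exact: (fsspanD Qh Qk).
pose J (s : 'I_r1 + 'I_r2) := match s with inl i => a i | inr j => a' j end.
pose aa := [ffun i => J (split i)].
have eaX : [ffun i => aa (lshift r2 i)] = a.
  by apply/ffunP => i; rewrite !ffunE (unsplitK (inl i)).
have eaY : [ffun i => aa (rshift r1 i)] = a'.
  by apply/ffunP => i; rewrite !ffunE (unsplitK (inr i)).
have Saa : sumones aa.
  split; [rewrite -Sa | rewrite -Sa']; apply: eq_bigr => i _; rewrite ffunE.
    by rewrite (unsplitK (inl i)).
  by rewrite (unsplitK (inr i)).
rewrite liftXM liftYM liftX_emb liftY_emb mulrACA.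
rewrite -embM -{1}(lmnm_join e e') -{2}(rmnm_join e e') -fsderivm_join -eaX -eaY -fsgen_join.
exact: fsspan_term.
Qed.

(** The image of the tensor product over C of the two submodules; the relation |u| = |v| has not
    been imposed here. *)
Definition tensor_sum (h : fsmod C (m + n) (r1 + r2)) :=
  exists t : seq (fsmod C m r1 * fsmod C n r2),
    (forall p, p \in t -> fsspan f sumone p.1 /\ fsspan g sumone p.2) /\
    h = \sum_(p <- t) liftX p.1 * liftY p.2.

Lemma tensor_sum0 : tensor_sum 0.
Proof. by exists [::]; rewrite big_nil. Qed.

Lemma tensor_sumD h1 h2 : tensor_sum h1 -> tensor_sum h2 -> tensor_sum (h1 + h2).
Proof.
move=> [t1 [s1 ->]] [t2 [s2 ->]]; exists (t1 ++ t2); split; last by rewrite big_cat.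
by move=> p; rewrite mem_cat => /orP [/s1|/s2].
Qed.

Lemma fsspan_join_tensor_sum h : fsspan (joinfam f g) sumones h -> tensor_sum h.
Proof.
move: h; apply: fsspan_ind => [||c b a [Sa1 Sa2]].
- exact: tensor_sum0.
- exact: tensor_sumD.
(* Derivatives and generators factor by themselves; only the coefficient has to be decomposed into a
   sum of products. *)
move: c; apply: plift_tensor_generated => [|x y Qx Qy|p q].
- rewrite (rmorph0 (@emb C (m + n) (r1 + r2))) mul0r; exact: tensor_sum0.
- rewrite (rmorphD (@emb C (m + n) (r1 + r2))) mulrDl; exact: (tensor_sumD Qx Qy).
exists [:: (emb p * fsderivm f (lmnm b) (fsgen f [ffun i => a (lshift r2 i)]),
  emb q * fsderivm g (rmnm b) (fsgen g [ffun i => a (rshift r1 i)]))]; split.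
  move=> p'; rewrite inE => /eqP ->; split; apply: fsspan_term.
    by rewrite -[RHS]Sa1; apply: eq_bigr => i _; rewrite ffunE.
  by rewrite -[RHS]Sa2; apply: eq_bigr => i _; rewrite ffunE.
rewrite big_seq1 fsgen_join fsderivm_join embM -liftX_emb -liftY_emb.
rewrite liftXM liftYM; exact: mulrACA.
Qed.

End JoinSpan.

(** * Clearing denominators *)

Section ClearDenominators.

Variables (C : fieldType) (m r : nat) (f : 'I_r -> {mpoly C[m]}).
Hypothesis f_neq0 : forall i, f i <> 0.

Definition prodpow k : {mpoly {mpoly C[m]}[r]} := ((\prod_i f i) ^+ k)%:MP.

(* After multiplication by (f_1 ... f_r)^k, h has polynomial coefficients. *)
Definition clears k (h : fsmod C m r) := exists p, emb (prodpow k) * h = emb p.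
Definition cleared h := exists k, clears k h.

Lemma prod_gens_neq0 : \prod_i f i != 0.
Proof. by apply/prodf_neq0 => i _; apply/eqP. Qed.

Lemma prodpowD k l : prodpow (k + l) = prodpow k * prodpow l.
Proof. by rewrite /prodpow exprD mpolyCM. Qed.

Lemma clearsW k l h : clears k h -> clears (l + k) h.
Proof.
move=> [p e]; exists (prodpow l * p).
rewrite prodpowD (embM (prodpow l) (prodpow k)) (embM (prodpow l) p) -mulrA.
exact: (congr1 (fun z => emb (prodpow l) * z) e).
Qed.

Lemma cleared2 h1 h2 : cleared h1 -> cleared h2 -> exists k, clears k h1 /\ clears k h2.
Proof.
move=> [k1 c1] [k2 c2]; exists (k1 + k2)%N; split; last exact: clearsW.
by rewrite addnC; exact: clearsW.
Qed.

Lemma clearedD h1 h2 : cleared h1 -> cleared h2 -> cleared (h1 + h2).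
Proof.
move=> c1 c2; have [k [[p1 e1] [p2 e2]]] := cleared2 c1 c2.
exists k, (p1 + p2); rewrite mulrDr [RHS]rmorphD; exact: (congr2 +%R e1 e2).
Qed.

Lemma clearedM h1 h2 : cleared h1 -> cleared h2 -> cleared (h1 * h2).
Proof.
move=> [k1 [p1 e1]] [k2 [p2 e2]]; exists (k1 + k2)%N, (p1 * p2).
rewrite prodpowD (embM (prodpow k1) (prodpow k2)) (embM p1 p2) mulrACA.
exact: (congr2 *%R e1 e2).
Qed.

Lemma cleared_emb p : cleared (emb p).
Proof. by exists 0%N, (prodpow 0 * p); rewrite (embM (prodpow 0) p). Qed.

Lemma cleared0 : cleared 0.
Proof. by exists 0%N, 0; rewrite mulr0 rmorph0. Qed.

Lemma cleared1 : cleared 1.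
Proof. by exists 0%N, (prodpow 0); rewrite mulr1. Qed.

Lemma cleared_prod (I : finType) (P : pred I) (F : I -> fsmod C m r) :
  (forall i, P i -> cleared (F i)) -> cleared (\prod_(i | P i) F i).
Proof. by move=> cF; apply: big_ind => //; [exact: cleared1 | exact: clearedM]. Qed.

Lemma cleared_sum (I : Type) (s : seq I) (F : I -> fsmod C m r) :
  (forall i, cleared (F i)) -> cleared (\sum_(i <- s) F i).
Proof. by move=> cF; apply: big_ind => //; [exact: cleared0 | exact: clearedD]. Qed.

Lemma clearedX h k : cleared h -> cleared (h ^+ k).
Proof.
move=> ch; elim: k => [|k IH]; first by rewrite expr0; exact: cleared1.
by rewrite exprS; exact: clearedM.
Qed.

Lemma cleared_loc x : loc f x -> cleared x%:MP.
Proof.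
move=> [a [k ->]]; exists k, a%:MP; rewrite !embC -mpolyCM; congr (_%:MP).
by rewrite mulrC divfK // tofrac_eq0 expf_neq0 // prod_gens_neq0.
Qed.

Lemma cleared_mpoly (q : fsmod C m r) : (forall e, loc f q@_e) -> cleared q.
Proof.
move=> lq; rewrite [q]mpolyE; apply: cleared_sum => e.
rewrite -mul_mpolyC -embX; apply: clearedM; last exact: cleared_emb.
exact: cleared_loc.
Qed.

Lemma cleared_inv i : cleared ((f i)%:F^-1)%:MP.
Proof.
apply: cleared_loc; exists (\prod_(j | j != i) f j), 1%N.
rewrite expr1 [X in _ / X%:F](bigD1 i) //= tofracM invfM mulrCA divff ?mulr1 //.
by rewrite tofrac_eq0; apply/prodf_neq0 => j _; apply/eqP.
Qed.

Lemma cleared_tofrac a : cleared a%:F%:MP.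
Proof. by rewrite -embC; exact: cleared_emb. Qed.

Lemma cleared_exprz i (z : int) : cleared ((f i)%:F ^ z)%:MP.
Proof.
case: z => k; first by rewrite -[_ ^ _]tofracXn; exact: cleared_tofrac.
by rewrite /exprz -exprVn rmorphXn; apply: clearedX; exact: cleared_inv.
Qed.

Lemma cleared_gbinom i k : cleared (gbinom 'X_i k).
Proof.
rewrite /gbinom -mul_mpolyC; apply: clearedM.
  (* The scalar 1/k! of [gbinom] lies in the fraction field; it is the image of a constant of C,
     hence needs no clearing. *)
  pose cst : {rmorphism C -> {fraction {mpoly C[m]}}} :=
    @FracField.tofrac {mpoly C[m]} \o @mpolyC m C.
  have -> : (k`!%:R^-1 : {fraction {mpoly C[m]}}) = cst (k`!%:R^-1).
    by rewrite fmorphV rmorph_nat.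
  exact: cleared_tofrac.
apply: cleared_prod => j _; rewrite -embX -(rmorph_nat (@emb C m r)) -rmorphB.
exact: cleared_emb.
Qed.

Lemma cleared_fsgen a : cleared (fsgen f a).
Proof.
rewrite /fsgen; apply: clearedM.
  by apply: cleared_prod => i _; exact: cleared_gbinom.
by rewrite rmorph_prod; apply: cleared_prod => i _; exact: cleared_exprz.
Qed.

Lemma map_fracderiv_emb k p :
  map_mpoly (fracderiv k) (emb p) = emb (map_mpoly (mderiv k) p) :> fsmod C m r.
Proof.
apply: map_mpoly_commute => c; exact: fracderiv_tofrac.
Qed.

(** The quotient rule for h = p / u: the square of a denominator of h clears its derivative. *)
Lemma square_leibniz (S : comPzRingType) (D : S -> S) (u du h p dp : S) :
  u * h = p -> D u = du -> D p = dp -> D (u * h) = D u * h + u * D h ->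
  u * u * D h = u * dp - du * p.
Proof. by move=> <- <- <- ->; ring. Qed.

Lemma cleared_map_fracderiv k h : cleared h -> cleared (map_mpoly (fracderiv k) h).
Proof.
move=> [d [p e]]; pose dk := @map_mpoly r _ _ (@mderiv m C k).
exists (d + d)%N, (prodpow d * dk p - dk (prodpow d) * p).
rewrite prodpowD (embM (prodpow d) (prodpow d)).
have eD := map_mpolyM_derivation (@fracderivM _ _ k) (emb (prodpow d)) h.
have eu := map_fracderiv_emb k (prodpow d); have ep := map_fracderiv_emb k p.
apply: (etrans (square_leibniz e eu ep eD)).
apply: esym; apply: (etrans (rmorphB (@emb C m r) _ _)).
exact: (congr2 (fun x y => x - y) (embM (prodpow d) (dk p)) (embM (dk (prodpow d)) p)).
Qed.

Lemma cleared_fsderiv k h : cleared h -> cleared (fsderiv f k h).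
Proof.
move=> ch; rewrite /fsderiv; apply: clearedD; first exact: cleared_map_fracderiv.
apply: clearedM => //; apply: cleared_sum => i; apply: clearedM.
  by rewrite mpolyCM; apply: clearedM; [exact: cleared_tofrac | exact: cleared_inv].
by rewrite -embX; exact: cleared_emb.
Qed.

Lemma cleared_fsspan S h : fsspan f S h -> cleared h.
Proof.
move: h; apply: fsspan_ind => [||c b a _]; first exact: cleared0.
  exact: clearedD.
apply: clearedM; first exact: cleared_emb.
rewrite /fsderivm; elim: (enum _) => [|i s IH]; first exact: cleared_fsgen.
rewrite [foldr _ _ _]/=; elim: (b i) => [|k IHk]; first exact: IH.
rewrite iterS; exact: cleared_fsderiv.
Qed.

End ClearDenominators.

(** * Integral functionals on modules over a principal ideal domain *)

(** The gcd is kept in the form [u * p + v * q], since this is the value of a linear map at the same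
    combination of its arguments. *)
Lemma Bezout_common_divisor (C : fieldType) (p q : {poly C}) :
  exists u v p' q', let d := u * p + v * q in p = d * p' /\ q = d * q'.
Proof.
have [[u v] /= e] := Bezoutp p q; exists u, v.
have dp : u * p + v * q %| p by rewrite (eqp_dvdl _ e) dvdp_gcdl.
have dq : u * p + v * q %| q by rewrite (eqp_dvdl _ e) dvdp_gcdr.
exists (p %/ (u * p + v * q)), (q %/ (u * p + v * q)).
by rewrite /= ![_ * (_ %/ _)]mulrC !divpK.
Qed.

Section Functionals.

Variables (C : fieldType) (M : comNzRingType) (tau : {rmorphism {poly C} -> M}).

Inductive tspan (s : seq M) : M -> Prop :=
| tspan0 : tspan s 0
| tspan_cons a y x : y \in s -> tspan s x -> tspan s (tau a * y + x).

Lemma tspanD s x y : tspan s x -> tspan s y -> tspan s (x + y).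
Proof.
move=> sx sy; elim: sx => [|a z w zs _ IH]; first by rewrite add0r.
by rewrite -addrA; constructor.
Qed.

Lemma tspanM s a x : tspan s x -> tspan s (tau a * x).
Proof.
elim=> [|b z w zs _ IH]; first by rewrite mulr0; constructor.
by rewrite mulrDr mulrA -rmorphM; constructor.
Qed.

Lemma tspan_mem s x : x \in s -> tspan s x.
Proof.
by move=> xs; have := tspan_cons 1 xs (tspan0 s); rewrite rmorph1 mul1r addr0.
Qed.

Lemma tspan_sub s t x : (forall y, y \in s -> tspan t y) -> tspan s x -> tspan t x.
Proof.
move=> st; elim=> [|a z w zs _ IH]; first by constructor.
by apply: tspanD => //; apply: tspanM; apply: st.
Qed.

Definition tlinear (K : pzRingType) (i : {poly C} -> K) (phi : M -> K) :=
  (forall x y, phi (x + y) = phi x + phi y) /\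
  (forall a x, phi (tau a * x) = i a * phi x).

Lemma tlinear0 (K : pzRingType) (i : {poly C} -> K) phi : tlinear i phi -> phi 0 = 0.
Proof. by move=> [phiD _]; apply: (addrI (phi 0)); rewrite -phiD !addr0. Qed.

Lemma tlinearB (c : M -> {poly C}) x a y :
  tlinear id c -> c (x - tau a * y) = c x - a * c y.
Proof. by move=> [cD cM]; rewrite -mulNr -rmorphN cD cM mulNr. Qed.

(** A finitely generated ideal of C[t] is principal; its generator is attained on the span because
    the Bezout combinations can be formed there before applying [c]. *)
Lemma tspan_image_generator (c : M -> {poly C}) s : tlinear id c ->
  exists2 n, tspan s n & forall x, tspan s x -> exists a, c x = c n * a.
Proof.
move=> lc; have [cD cM] := lc; elim: s => [|x0 s [n sn nP]].
  exists 0 => [|x]; first by constructor.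
  by case=> // ; exists 0; rewrite mulr0 (tlinear0 lc).
have sub y : tspan s y -> tspan (x0 :: s) y.
  by apply: tspan_sub => z zs; apply: tspan_mem; rewrite inE zs orbT.
have [u [v [p [q [ep eq]]]]] := Bezout_common_divisor (c x0) (c n).
exists (tau u * x0 + tau v * n).
  by apply: tspanD; apply: tspanM; [apply: tspan_mem; rewrite inE eqxx | exact: sub].
have cn : c (tau u * x0 + tau v * n) = u * c x0 + v * c n by rewrite cD !cM.
rewrite cn; set d := _ + _ in ep eq *; move=> x.
elim=> [|a z w]; first by exists 0; rewrite (tlinear0 lc) mulr0.
rewrite inE => zs _ [b ew]; rewrite cD cM ew.
have [e ->] : exists e, c z = d * e.
  case/orP: zs => [/eqP ->|zs]; first by exists p.
  have [e ->] := nP _ (tspan_mem zs); exists (q * e).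
  by rewrite mulrA -eq.
by exists (a * e + b); rewrite mulrDr mulrCA.
Qed.

Lemma integral_functional (cs : seq (M -> {poly C})) (s : seq M) v :
  (forall i, (i < size cs)%N -> tlinear id (nth (fun=> 0) cs i)) ->
  (forall x, tspan s x ->
     (forall i, (i < size cs)%N -> nth (fun=> 0) cs i x = 0) -> x = 0) ->
  tspan s v ->
  exists d z (phi : M -> {fraction {poly C}}),
    [/\ v = tau d * z, tspan s z, tlinear (@FracField.tofrac _) phi,
        forall x, tspan s x -> exists a, phi x = a%:F & phi v = d%:F].
Proof.
(* The image of the span under c is a principal ideal, generated by g = c n. The
   kernel of c on the span is spanned by the x - (c x / g) n, x in s, and the
   remaining functionals separate its points. *)
elim: cs s v => [|c cs IH] s v lin sep sv.
  (* No functional is left to separate points, so the span is 0 and d = 0 serves. *)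
  exists 0, 0, (fun=> 0); rewrite rmorph0 mul0r tofrac0; split=> //.
  - exact: sep.
  - by constructor.
  - by split=> *; rewrite ?addr0 ?mulr0.
  by move=> x _; exists 0; rewrite tofrac0.
have lc : tlinear id c := lin 0%N isT.
have lin' i : (i < size cs)%N -> tlinear id (nth (fun=> 0) cs i) by exact: (lin i.+1).
have [n sn nP] := tspan_image_generator s lc.
have [cn0|cn0] := eqVneq (c n) 0.
  apply: IH => // x sx cx; apply: sep => // -[|i] i_lt; last exact: cx.
  by have [a /= ->] := nP x sx; rewrite cn0 mul0r.
have [cD cM] := lc; pose g := c n; pose red x := x - tau (c x %/ g) * n.
have gK x : tspan s x -> (c x %/ g) * g = c x.
  by move=> /nP [a e]; rewrite divpK // e dvdp_mulr.
have redK x : x = red x + tau (c x %/ g) * n by rewrite subrK.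
have red_span x : tspan s x -> tspan (map red s) (red x).
  elim=> [|a z w zs sw IHw].
    by rewrite /red (tlinear0 lc) div0p rmorph0 mul0r subr0; constructor.
  have -> : red (tau a * z + w) = tau a * red z + red w.
    rewrite /red cD cM divpD -divp_mulA; last first.
      by have [e ->] := nP _ (tspan_mem zs); rewrite dvdp_mulr.
    by rewrite rmorphD rmorphM; ring.
  by constructor => //; apply: map_f.
have red_sub x : tspan (map red s) x -> tspan s x.
  apply: tspan_sub => _ /mapP [y ys ->]; apply: tspanD; first exact: tspan_mem.
  by rewrite -mulNr -rmorphN; exact: tspanM.
have c_red x : tspan (map red s) x -> c x = 0.
  elim=> [|a _ w /mapP [y ys ->] _ cw]; first exact: tlinear0 lc.
  by rewrite cD cM cw tlinearB // gK ?subrr ?mulr0 ?addr0 //; exact: tspan_mem.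
have sep' x : tspan (map red s) x ->
    (forall i, (i < size cs)%N -> nth (fun=> 0) cs i x = 0) -> x = 0.
  move=> sx cx; apply: sep => [|[|i]]; [exact: red_sub| |exact: cx].
  by move=> _; exact: c_red.
have [d1 [z1 [phi1 [ev1 sz1 lphi1 iphi1 phiv1]]]] := IH _ _ lin' sep' (red_span v sv).
pose gam := c v %/ g.
(* [red v] is divisible by [d1], and [gam] is the coordinate of [v] along [n]; their gcd [h] can be
   extracted from [v]. The multipliers [al] and [be] weight the two functionals so that the value at
   [v] is [h]. *)
have [al [be [d1' [gam' [ed eg]]]]] := Bezout_common_divisor d1 gam.
set h := _ + _ in ed eg; have [phiD phiM] := lphi1.
have g0 : g%:F != 0 by rewrite tofrac_eq0.
(* On the span this is [al] times [phi1 (red x)] plus [be] times the coordinate along [n]. The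
   fraction c x / g is used in place of [c x %/ g] because it is compatible with scalars on all of
   M, not just on the span. *)
pose phi x := al%:F * (phi1 x - phi1 n * ((c x)%:F / g%:F)) + be%:F * ((c x)%:F / g%:F).
have phi_red x : tspan s x -> phi x = al%:F * phi1 (red x) + be%:F * (c x %/ g)%:F.
  move=> sx; rewrite /phi; have -> : (c x)%:F / g%:F = (c x %/ g)%:F.
    by rewrite -{1}(gK _ sx) tofracM mulfK.
  by rewrite {1}[x]redK phiD phiM [phi1 n * _]mulrC addrK.
exists h, (tau d1' * z1 + tau gam' * n), phi; split.
- rewrite {1}[v]redK ev1 -/gam ed {1}eg.
  by rewrite !rmorphM /=; ring.
- apply: tspanD; apply: tspanM => //; exact: red_sub.
- split=> [x y|a x]; rewrite /phi.
    by rewrite cD phiD tofracD; ring.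
  by rewrite cM phiM tofracM; ring.
- move=> x sx; rewrite phi_red //; have [a ->] := iphi1 _ (red_span x sx).
  by exists (al * a + be * (c x %/ g)); rewrite tofracD !tofracM.
by rewrite phi_red // phiv1 -!tofracM -tofracD.
Qed.

End Functionals.

(** * Polynomials in the indeterminates as a module over their sum *)

Section Coordinates.

Variables (C : fieldType) (m r : nat).
Local Notation M := {mpoly {mpoly C[m]}[r]}.
Local Notation N := {mpoly {mpoly {poly C}[m]}[r]}.

Definition cst : C -> M := @mpolyC r {mpoly C[m]} \o @mpolyC m C.
HB.instance Definition _ := GRing.RMorphism.copy cst
  (@mpolyC r {mpoly C[m]} \o @mpolyC m C).

(* The structure map of the C[t]-module C[x][s], with t acting as |s|. *)
Definition tau : {poly C} -> M := horner_eval (\sum_i 'X_i) \o map_poly cst.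
HB.instance Definition _ := GRing.RMorphism.copy tau
  (horner_eval (\sum_i 'X_i) \o map_poly cst).

Lemma tauC c : tau c%:P = cst c.
Proof. by rewrite /tau /= map_polyC /horner_eval hornerC. Qed.

Lemma tauX : tau 'X = \sum_i 'X_i.
Proof. by rewrite /tau /= map_polyX /horner_eval hornerX. Qed.

Definition polycst : {poly C} -> N := @mpolyC r {mpoly {poly C}[m]} \o @mpolyC m {poly C}.
HB.instance Definition _ := GRing.RMorphism.copy polycst
  (@mpolyC r {mpoly {poly C}[m]} \o @mpolyC m {poly C}).

Lemma poly_rmorph_eq (S : nzRingType) (p1 p2 : {rmorphism {poly C} -> S}) :
  (forall c, p1 c%:P = p2 c%:P) -> p1 'X = p2 'X -> p1 =1 p2.
Proof.
move=> eC eX; elim/poly_ind => [|p c IH]; first by rewrite !rmorph0.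
by rewrite !rmorphD !rmorphM /= IH eC eX.
Qed.

Section Substitution.

Variable i0 : 'I_r.

Definition coefP : {mpoly C[m]} -> N :=
  @mpolyC r {mpoly {poly C}[m]} \o map_mpoly (@polyC C).
HB.instance Definition _ := GRing.RMorphism.copy coefP
  (@mpolyC r {mpoly {poly C}[m]} \o map_mpoly (@polyC C)).

(* Eliminating s_{i0} in favour of t = |s| identifies C[x][s] with a subring of
   C[t][x][s], in which the coefficients of monomials in x and s are C[t]-linear. *)
Definition subst_var (i : 'I_r) : N :=
  'X_i + (i == i0)%:R * (polycst 'X - \sum_j 'X_j).

Definition sigma : M -> N := mmap coefP subst_var.
HB.instance Definition _ := GRing.RMorphism.copy sigma (mmap coefP subst_var).

Definition back1 : {mpoly {poly C}[m]} -> M := mmap tau (fun k => ('X_k)%:MP).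
HB.instance Definition _ := GRing.RMorphism.copy back1 (mmap tau (fun k => ('X_k)%:MP)).

Definition back : N -> M := mmap back1 (fun i => 'X_i).
HB.instance Definition _ := GRing.RMorphism.copy back (mmap back1 (fun i => 'X_i)).

Lemma sigmaC c : sigma c%:MP = coefP c.
Proof. exact: mmapC. Qed.

Lemma sigmaX i : sigma 'X_i = subst_var i.
Proof. by rewrite /sigma mmapX mmap1U. Qed.

(** The correction t - |s| enters exactly once in the image of |s|, at [i0], and turns it into t.
    Thus C[t] acts by constant coefficients after [sigma], which makes the coordinates linear. *)
Lemma sigma_tau a : sigma (tau a) = polycst a.
Proof.
move: a; apply: (@poly_rmorph_eq _ (sigma \o tau) polycst) => [c|] /=.
  by rewrite tauC sigmaC /coefP /= map_mpolyC.
rewrite tauX rmorph_sum /= (eq_bigr _ (fun i _ => sigmaX i)) big_split /=.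
rewrite -mulr_suml [X in _ + X * _](bigD1 i0) //= eqxx [X in (_ + X) * _]big1 => [|i /negPf -> //].
by rewrite addr0 mul1r; exact: subrKC.
Qed.

Lemma backC c : back c%:MP = back1 c.
Proof. exact: mmapC. Qed.

Lemma backX i : back 'X_i = 'X_i.
Proof. by rewrite /back mmapX mmap1U. Qed.

Lemma back1C a : back1 a%:MP = tau a.
Proof. exact: mmapC. Qed.

Lemma back1X i : back1 'X_i = ('X_i)%:MP.
Proof. by rewrite /back1 mmapX mmap1U. Qed.

Lemma sigmaK : cancel sigma back.
Proof.
apply: (@mpoly_rmorph_eq _ _ _ (back \o sigma) idfun) => [c|i] /=.
  rewrite sigmaC /coefP /= backC; move: c.
  apply: (@mpoly_rmorph_eq _ _ _ (back1 \o map_mpoly (@polyC C))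
    (@mpolyC r {mpoly C[m]})) => [c|k] /=.
    by rewrite map_mpolyC back1C tauC.
  by rewrite map_mpolyX back1X.
rewrite sigmaX /subst_var rmorphD rmorphM rmorphB rmorph_nat /=.
rewrite rmorph_sum /= (eq_bigr _ (fun i _ => backX i)) backX.
by rewrite /polycst /= backC back1C tauX subrr mulr0 addr0.
Qed.

Definition tcoord (p : 'X_{1..r} * 'X_{1..m}) (x : M) : {poly C} := (sigma x)@_p.1@_p.2.

Lemma tcoord_linear p : tlinear tau id (tcoord p).
Proof.
split=> [x y|a x]; rewrite /tcoord; first by rewrite rmorphD !mcoeffD.
by rewrite rmorphM /= sigma_tau /polycst /= !mcoeffCM.
Qed.

Definition tau_span : seq M -> M -> Prop := tspan tau.

Lemma tau_span_ind (s : seq M) (Q : M -> Prop) :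
  Q 0 -> (forall a y x, y \in s -> Q x -> Q (tau a * y + x)) ->
  forall z, tau_span s z -> Q z.
Proof. by move=> Q0 QD z; elim=> // a y x ys _; exact: QD. Qed.

Lemma tau_span_mem (s : seq M) x : x \in s -> tau_span s x.
Proof. exact: tspan_mem. Qed.

Definition tau_functional (phi : M -> {fraction {poly C}}) :=
  tlinear tau (@FracField.tofrac _) phi.

Lemma tau_functionalD phi : tau_functional phi ->
  forall x y, phi (x + y) = phi x + phi y.
Proof. by case. Qed.

Lemma tau_functionalM phi : tau_functional phi ->
  forall a x, phi (tau a * x) = a%:F * phi x.
Proof. by case. Qed.

Lemma tau_functional0 phi : tau_functional phi -> phi 0 = 0.
Proof. exact: tlinear0. Qed.

Lemma tau_functionalZ phi k a e : tau_functional phi ->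
  phi ((k *: 'X_[a]) *: 'X_[e]) = k%:P%:F * phi ('X_[a] *: 'X_[e]).
Proof.
move=> phi_lin; rewrite -(tau_functionalM phi_lin); congr phi.
by rewrite tauC /cst /= mul_mpolyC scalerA mul_mpolyC.
Qed.

(** A finite span involves finitely many coordinates: [L] contains every pair of exponents occurring
    in a generator. These coordinates separate points of the span because [sigma] is injective. *)
Lemma tau_integral_functional (s : seq M) (v : M) : tau_span s v ->
  exists d z (phi : M -> {fraction {poly C}}),
    [/\ v = tau d * z, tau_span s z, tau_functional phi,
        forall x, tau_span s x -> exists a, phi x = a%:F & phi v = d%:F].
Proof.
pose E := flatten [seq msupp (sigma y) | y <- s].
pose A := flatten [seq msupp (sigma y)@_e | y <- s, e <- E].
pose L := [seq (e, a) | e <- E, a <- A].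
have L0 p x : tspan tau s x -> p \notin L -> tcoord p x = 0.
  have [cD cM] := tcoord_linear p; move=> sx pL.
  elim: sx => [|a y w ys _ IH]; first exact: tlinear0 (tcoord_linear p).
  rewrite cD cM IH addr0; suff -> : tcoord p y = 0 by rewrite mulr0.
  case: p pL {cD cM IH} => e b; apply: contraNeq => c0.
  have eE : e \in E.
    apply/flatten_mapP; exists y => //; rewrite mcoeff_msupp.
    by apply: contraNneq c0 => e0; rewrite /tcoord e0 mcoeff0.
  apply: allpairs_f => //; apply/flattenP; exists (msupp (sigma y)@_e).
    exact: allpairs_f.
  by rewrite mcoeff_msupp.
move=> sv; apply: (@integral_functional _ _ tau (map tcoord L)) => //.
  move=> i; rewrite size_map => i_lt; rewrite (nth_map (0%MM, 0%MM)) //.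
  exact: tcoord_linear.
move=> x sx cx; rewrite -[x]sigmaK; have -> : sigma x = 0; last exact: rmorph0.
apply/mpolyP => e; apply/mpolyP => b; rewrite !mcoeff0 -[LHS]/(tcoord (e, b) x).
have [pL|/L0 -> //] := boolP ((e, b) \in L).
have <- : nth (fun=> 0) (map tcoord L) (index (e, b) L) = tcoord (e, b).
  rewrite (nth_map (0%MM, 0%MM)); last by rewrite index_mem.
  exact: (congr1 tcoord (nth_index _ pL)).
by apply: cx; rewrite size_map index_mem.
Qed.

(** As [G] is free of s, its leading coefficient is a coordinate that is a non-zero constant of
    C[t], so [d] cannot divide [G] unless constant; comparing this coordinate moves [d] into [b]. *)
Lemma tau_dvd (G : {mpoly C[m]}) b d z : G != 0 -> tau b * G%:MP = tau d * z -> d %| b.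
Proof.
move=> G0 /(congr1 (tcoord (0%MM, mlead G))).
have [_ cM] := tcoord_linear (0%MM, mlead G); rewrite !cM {1}/tcoord /=.
rewrite sigmaC /coefP /= mcoeffC eqxx mulr1 mcoeff_map_mpoly => e.
have l0 : G@_(mlead G) != 0 by rewrite mleadc_eq0.
by rewrite -(dvdpZr _ b l0) -mul_polyC mulrC [X in _ %| X]e dvdp_mulr.
Qed.

Lemma tau_cancel d x y : d != 0 -> tau d * x = tau d * y -> x = y.
Proof.
move=> d0 exy; apply: (can_inj sigmaK); apply/mpolyP => e; apply/mpolyP => a.
have [_ cM] := tcoord_linear (e, a); have := congr1 (tcoord (e, a)) exy.
by rewrite !cM; exact: mulfI.
Qed.

End Substitution.
End Coordinates.

(** * The product of two functionals, defined through monomials *)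

Section CoefficientwiseSum.

Variables (n : nat) (R : nzRingType) (V : zmodType) (w : 'X_{1..n} -> R -> V).
Hypothesis wD : forall e x y, w e (x + y) = w e x + w e y.

Definition coefsum (p : {mpoly R[n]}) : V := \sum_(e <- msupp p) w e p@_e.

Let w0 e : w e 0 = 0.
Proof. by apply: (addrI (w e 0)); rewrite -wD !addr0. Qed.

(** Supports vary under addition; a sum over all exponents below a common bound does not, and makes
    additivity termwise. *)
Lemma coefsumE k p : (msize p <= k)%N ->
  coefsum p = \sum_(e : 'X_{1..n < k}) w e p@_e.
Proof.
move=> le_pk; rewrite /coefsum (ssrcomplements.big_mksub 'X_{1..n < k}) ?msupp_uniq //=; last first.
  by move=> x /msize_mdeg_lt /leq_trans; apply.
by rewrite big_rmcond //= => j /memN_msupp_eq0 ->.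
Qed.

Lemma coefsumD p q : coefsum (p + q) = coefsum p + coefsum q.
Proof.
pose k := maxn (msize p) (msize q).
rewrite !(@coefsumE k) ?leq_maxl ?leq_maxr ?msizeD_le // -big_split /=.
by apply: eq_bigr => e _; rewrite mcoeffD wD.
Qed.

Lemma coefsumZX c e : coefsum (c *: 'X_[e]) = w e c.
Proof.
rewrite /coefsum; have [->|c0] := eqVneq c 0; first by rewrite scale0r msupp0 big_nil w0.
by rewrite msuppMCX // big_seq1 mcoeffZ mcoeffX eqxx mulr1.
Qed.

End CoefficientwiseSum.

Lemma mpoly2_ind (C : nzRingType) m r (Q : {mpoly {mpoly C[m]}[r]} -> Prop) :
  Q 0 -> (forall p q, Q p -> Q q -> Q (p + q)) ->
  (forall k a e, Q ((k *: 'X_[a]) *: 'X_[e])) -> forall p, Q p.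
Proof.
move=> Q0 QD QX; elim/mpolyind => // c e p _ _; apply: (QD).
elim/mpolyind: c => [|k a c _ _ Qc]; first by rewrite scale0r.
by rewrite scalerDl; apply: QD.
Qed.

Lemma exchange_factor (S : comPzRingType) (x y p q xp yq : S) :
  xp = x * p -> yq = y * q -> (x - y) * (p * q) + p * yq = xp * q.
Proof. by move=> -> ->; ring. Qed.

Lemma exchange_scalar (S : comPzRingType) (x a b xa xb : S) :
  xa = x * a -> xb = x * b -> xa * b = a * xb.
Proof. by move=> -> ->; ring. Qed.

Section ProductFunctional.

Variables (C : fieldType) (m n r1 r2 : nat).
Local Notation M1 := {mpoly {mpoly C[m]}[r1]}.
Local Notation M2 := {mpoly {mpoly C[n]}[r2]}.
Local Notation M12 := {mpoly {mpoly C[m + n]}[r1 + r2]}.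
Local Notation K := {fraction {poly C}}.
Local Notation pliftX := (@pliftX C m n r1 r2).
Local Notation pliftY := (@pliftY C m n r1 r2).

Variables (phi : M1 -> K) (psi : M2 -> K).
Hypothesis phi_lin : tau_functional phi.
Hypothesis psi_lin : tau_functional psi.

Let weight (e : 'X_{1..r1 + r2}) (a : 'X_{1..m + n}) (k : C) : K :=
  k%:P%:F * (phi ('X_[lmnm a] *: 'X_[lmnm e]) * psi ('X_[rmnm a] *: 'X_[rmnm e])).

(* x^a y^a' u^e v^e' is sent to phi (x^a u^e) * psi (y^a' v^e'). *)
Definition prodfun (p : M12) : K := coefsum (fun e => coefsum (weight e)) p.

Let weightD e a x y : weight e a (x + y) = weight e a x + weight e a y.
Proof. by rewrite /weight polyCD tofracD mulrDl. Qed.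

Lemma prodfunD p q : prodfun (p + q) = prodfun p + prodfun q.
Proof. by apply: coefsumD => e x y; apply: coefsumD; exact: weightD. Qed.

Lemma prodfunZX k a e : prodfun ((k *: 'X_[a]) *: 'X_[e]) = weight e a k.
Proof.
rewrite /prodfun coefsumZX => [|e' x y]; last by apply: coefsumD; exact: weightD.
by apply: coefsumZX; exact: weightD.
Qed.

Lemma prodfun0 : prodfun 0 = 0.
Proof. by apply: (addrI (prodfun 0)); rewrite -prodfunD !addr0. Qed.

Lemma plift_monomials k a e k' a' e' :
  pliftX ((k *: 'X_[a]) *: 'X_[e]) * pliftY ((k' *: 'X_[a']) *: 'X_[e']) =
  ((k * k') *: 'X_[joinmnm a a']) *: 'X_[joinmnm e e'].
Proof.
have eX : pliftX ((k *: 'X_[a]) *: 'X_[e]) =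
    (k *: mren (@lshift m n) 'X_[a]) *: mren (@lshift r1 r2) 'X_[e].
  by apply: (etrans (mliftZX _ _ _ _)); congr (_ *: _); exact: comp_mpolyZ.
have eY : pliftY ((k' *: 'X_[a']) *: 'X_[e']) =
    (k' *: mren (@rshift m n) 'X_[a']) *: mren (@rshift r1 r2) 'X_[e'].
  by apply: (etrans (mliftZX _ _ _ _)); congr (_ *: _); exact: comp_mpolyZ.
rewrite eX eY -scalerMM -scalerMM {eX eY}.
rewrite (mpolyX_split _ (joinmnm a a')) (mpolyX_split _ (joinmnm e e')).
by rewrite !lmnm_join !rmnm_join.
Qed.

Lemma prodfun_lift p q : prodfun (pliftX p * pliftY q) = phi p * psi q.
Proof.
have phiD := tau_functionalD phi_lin; have psiD := tau_functionalD psi_lin.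
elim/mpoly2_ind: p => [|p1 p2 e1 e2|k a e].
- by rewrite (rmorph0 pliftX) mul0r prodfun0 (tau_functional0 phi_lin) mul0r.
- rewrite (rmorphD pliftX) mulrDl prodfunD phiD mulrDl; exact: (congr2 +%R e1 e2).
elim/mpoly2_ind: q => [|q1 q2 e1 e2|k' a' e'].
- by rewrite (rmorph0 pliftY) mulr0 prodfun0 (tau_functional0 psi_lin) mulr0.
- rewrite (rmorphD pliftY) mulrDr prodfunD psiD mulrDr; exact: (congr2 +%R e1 e2).
rewrite plift_monomials prodfunZX /weight !lmnm_join !rmnm_join.
rewrite (tau_functionalZ _ _ _ phi_lin) (tau_functionalZ _ _ _ psi_lin).
rewrite polyCM tofracM; exact: mulrACA.
Qed.

(** On a product of lifts, multiplication by t in either factor pulls out the same scalar of the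
    fraction field of C[t]. Hence [prodfun] respects the relation |u| = |v|. *)
Lemma prodfun_tau_diff p : prodfun ((pliftX (tau _ _ 'X) - pliftY (tau _ _ 'X)) * p) = 0.
Proof.
move: p; apply: plift_tensor_generated => [|x y ex ey|p q].
- by rewrite mulr0 prodfun0.
- rewrite mulrDr prodfunD; exact: (etrans (congr2 +%R ex ey) (addr0 0)).
have phiM := tau_functionalM phi_lin; have psiM := tau_functionalM psi_lin.
(* Adding this term leaves a single product of lifts on each side, where [prodfun_lift] applies. *)
apply: (addIr (prodfun (pliftX p * pliftY (tau _ _ 'X * q)))).
rewrite add0r -prodfunD.
have -> : (pliftX (tau _ _ 'X) - pliftY (tau _ _ 'X)) * (pliftX p * pliftY q) +
    pliftX p * pliftY (tau _ _ 'X * q) = pliftX (tau _ _ 'X * p) * pliftY q.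
  exact: (exchange_factor (rmorphM pliftX (tau _ _ 'X) p) (rmorphM pliftY (tau _ _ 'X) q)).
apply: (etrans (prodfun_lift _ _)); apply: (etrans _ (esym (prodfun_lift _ _))).
exact: (exchange_scalar (phiM 'X p) (psiM 'X q)).
Qed.

End ProductFunctional.

(** * The annihilator of one ideal *)

(** A morphism out of C[t] that fixes the constants is evaluation at the image of t; this identifies
    [polyat] with the action of C[t]. *)
Lemma polyat_rmorph (C : fieldType) m r (phi : {rmorphism {poly C} -> fsmod C m r}) b :
  (forall c, phi c%:P = emb (cst m r c)) -> polyat b (phi 'X) = phi b.
Proof.
move=> phiC; rewrite /polyat.
rewrite (eq_map_poly (g := phi \o polyC)) => [|c]; last first.
  by rewrite /= phiC /cst /= embC.
elim/poly_ind: b => [|b c IH].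
  by rewrite map_poly0 horner0 rmorph0.
rewrite !rmorphD !rmorphM /= map_polyX map_polyC hornerD hornerM hornerX hornerC.
by rewrite IH.
Qed.

Section OneFactor.

Variables (C : fieldType) (m r : nat) (f : 'I_r -> {mpoly C[m]}).
Hypothesis f_neq0 : forall i, f i <> 0.
Local Notation sumone := (fun a : {ffun 'I_r -> int} => \sum_i a i = 1).
Local Notation tau := (@tau C m r).
Local Notation cst := (@cst C m r).

Lemma emb_sumX : emb (\sum_i 'X_i) = \sum_i 'X_i :> fsmod C m r.
Proof. by rewrite rmorph_sum; apply: eq_bigr => i _; exact: embX. Qed.

Lemma polyat_tau b : polyat b (\sum_i 'X_i) = emb (tau b) :> fsmod C m r.
Proof.
have := @polyat_rmorph C m r (@emb C m r \o tau) b.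
rewrite /= tauX emb_sumX; apply => c.
exact: (congr1 (@emb C m r) (tauC m r c)).
Qed.

Lemma emb_eq0 p : (emb p == 0 :> fsmod C m r) = (p == 0).
Proof. by rewrite -(inj_eq (@emb_inj C m r)) rmorph0. Qed.

(* y / (f_1 ... f_r)^K belongs to the submodule defining the Bernstein-Sato
   polynomial. *)
Definition numerator K y := exists h, fsspan f sumone h /\ emb (prodpow f K) * h = emb y.

Lemma numerator_tspan K s z :
  (forall y, y \in s -> numerator K y) -> tau_span s z -> numerator K z.
Proof.
move=> sK; move: z; apply: tau_span_ind => [|a y x ys [hx [fx ex]]].
  by exists 0; split; [exact: fsspan0 | rewrite mulr0 rmorph0].
have [hy [fy ey]] := sK y ys; exists (emb (tau a) * hy + hx); split.
  by apply: fsspanD => //; exact: fsspanM.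
rewrite mulrDr mulrCA; apply: (etrans (congr2 (fun u v => emb (tau a) * u + v) ey ex)).
rewrite -embM; exact/esym/rmorphD.
Qed.

Lemma prodpow_neq0 K : prodpow f K != 0 :> {mpoly {mpoly C[m]}[r]}.
Proof. by rewrite /prodpow mpolyC_eq0 expf_neq0 // prod_gens_neq0. Qed.

Definition annihilates c := fsspan f sumone (emb (tau c)).

Lemma annihilatesZ (k : C) c : annihilates c -> annihilates (k *: c).
Proof.
move=> fc; rewrite /annihilates -mul_polyC rmorphM.
have -> := embM (tau k%:P) (tau c); exact: fsspanM.
Qed.

Lemma numerator_annihilates K c : numerator K (tau c * prodpow f K) -> annihilates c.
Proof.
move=> [h [fh eh]]; suff e : h = emb (tau c) by rewrite /annihilates -e.
have p0 : emb (prodpow f K) != 0 :> fsmod C m r by rewrite emb_eq0 prodpow_neq0.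
apply: (mulfI p0); apply: (etrans eh); apply: (etrans (embM _ _)); exact: mulrC.
Qed.

Lemma annihilates_numerator K c : annihilates c -> numerator K (tau c * prodpow f K).
Proof.
move=> fc; exists (emb (tau c)); split=> //.
apply: (etrans (mulrC _ _)); exact/esym/embM.
Qed.

(* In terms of numerators over (f_1 ... f_r)^K, phi(f^s) = delta / b. *)
Lemma isBSpoly_dual (b : {poly C}) (i0 : 'I_r) K (s : seq {mpoly {mpoly C[m]}[r]}) :
  isBSpoly f b ->
  (forall y, y \in s -> numerator K y) ->
  exists phi delta, [/\ tau_functional phi, delta != 0,
    forall y, y \in s -> exists a, phi y = a%:F
    & b%:F * phi (prodpow f K) = delta%:P%:F].
Proof.
move=> [b_monic b_ann b_min] sK.
have bann : annihilates b by rewrite /annihilates -polyat_tau.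
(* The numerator of b(t) f^s is adjoined so that it lies in the span from which a factor [d] is
   extracted. *)
pose s' := tau b * prodpow f K :: s.
have s'K y : y \in s' -> numerator K y.
  by rewrite inE => /orP [/eqP ->|]; [exact: annihilates_numerator | exact: sK].
have mem_v : tau_span s' (tau b * prodpow f K) by apply: tau_span_mem; rewrite inE eqxx.
have [d [z [phi [ev sz phi_lin phi_int phi_v]]]] := tau_integral_functional i0 mem_v.
have d_dvd : d %| b.
  by apply: (tau_dvd i0 _ ev); rewrite expf_neq0 // prod_gens_neq0.
have b0 : b != 0 by exact: monic_neq0.
have d0 : d != 0 by apply: contraNneq b0 => d0; rewrite d0 dvd0p in d_dvd.
pose c := b %/ d; have ebc : b = d * c by rewrite mulrC divpK.
have c0 : c != 0 by apply: contraNneq b0 => c0; rewrite ebc c0 mulr0.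
(* Cancelling [d] identifies [z] with the numerator of c(t) f^s, and [z] lies in the span. *)
have c_ann : annihilates c.
  apply: (@numerator_annihilates K); suff <- : z = tau c * prodpow f K.
    exact: numerator_tspan sz.
  have e : tau d * (tau c * prodpow f K) = tau b * prodpow f K.
    apply: (etrans (mulrA _ _ _)); apply: (congr1 (fun x => x * prodpow f K)).
    exact: (etrans (esym (rmorphM tau d c)) (congr1 tau (esym ebc))).
  exact: (tau_cancel i0 d0 (etrans (esym ev) (esym e))).
have size_d : size d = 1%N.
  have lc0 : lead_coef c != 0 by rewrite lead_coef_eq0.
  (* [c] is made monic for the comparison; minimality of [b] = [d * c] then leaves degree 0 for
     [d]. *)
  have := b_min ((lead_coef c)^-1 *: c).
  rewrite monicE lead_coefZ mulVf // eqxx polyat_tau => /(_ isT).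
  move=> /(_ (annihilatesZ _ c_ann)).
  rewrite size_scale ?invr_eq0 // {1}ebc size_mul //.
  have : (0 < size d)%N by rewrite size_poly_gt0.
  have : (0 < size c)%N by rewrite size_poly_gt0.
  by case: (size d) => [//|[//|k]]; case: (size c) => [//|l]; lia.
have [delta delta0 ed] : exists2 delta, delta != 0 & d = delta%:P.
  by apply/size_poly1P; rewrite size_d.
exists phi, delta; split=> //.
  by move=> y ys; apply: phi_int; apply: tau_span_mem; rewrite inE ys orbT.
by rewrite -(tau_functionalM phi_lin) phi_v ed.
Qed.

End OneFactor.

(** * The annihilator of a product *)

Lemma clear_equation (S : comPzRingType) (x y u q d : S) :
  x - y = u * q -> x * d = d * y + u * (d * q).
Proof. by move=> e; rewrite mulrCA -e; ring. Qed.

(** The divisibility of b(x) - b(y) by x - y; it allows b_J to be evaluated at |v| in place of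
    |u|. *)
Lemma rmorph_diff_factor (C : fieldType) (S : comNzRingType)
    (alpha beta : {rmorphism {poly C} -> S}) :
  (forall c, alpha c%:P = beta c%:P) ->
  forall b, exists w, alpha b - beta b = (alpha 'X - beta 'X) * w.
Proof.
move=> eC; elim/poly_ind => [|b c [w ew]].
  by exists 0; rewrite !rmorph0 subrr mulr0.
exists (w * alpha 'X + beta b).
rewrite !rmorphD !rmorphM /= eC mulrDr mulrA -ew; ring.
Qed.

Lemma factor_difference (S : comPzRingType) (a b1 b2 d w : S) :
  b1 - b2 = d * w -> a * b1 - a * b2 = d * (a * w).
Proof. by move=> e; rewrite -mulrBr e mulrCA. Qed.

Section ProductBSpoly.

Variables (C : fieldType) (m n r1 r2 : nat).
Variables (f : 'I_r1 -> {mpoly C[m]}) (g : 'I_r2 -> {mpoly C[n]}).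
Hypothesis f_neq0 : forall i, f i <> 0.
Hypothesis g_neq0 : forall j, g j <> 0.

Local Notation fg := (joinfam f g).
Local Notation liftX := (@liftX C m n r1 r2).
Local Notation liftY := (@liftY C m n r1 r2).
Local Notation pliftX := (@pliftX C m n r1 r2).
Local Notation pliftY := (@pliftY C m n r1 r2).
Local Notation tau1 := (@tau C m r1).
Local Notation tau2 := (@tau C n r2).
Local Notation emb12 := (@emb C (m + n) (r1 + r2)).
Local Notation M1 := {mpoly {mpoly C[m]}[r1]}.
Local Notation M2 := {mpoly {mpoly C[n]}[r2]}.
Local Notation M12 := {mpoly {mpoly C[m + n]}[r1 + r2]}.

Lemma joinfam_neq0 i : fg i <> 0.
Proof.
case: (split_ordP i) => j ->.
  rewrite joinfam_lshift => e; apply: (@f_neq0 j); apply: (mren_inj (@lshift_inj m n)).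
  by rewrite e rmorph0.
rewrite joinfam_rshift => e; apply: (@g_neq0 j); apply: (mren_inj (@rshift_inj m n)).
by rewrite e rmorph0.
Qed.

Lemma pliftXC c : pliftX c%:MP = (mren (@lshift m n) c)%:MP.
Proof. exact: mliftC. Qed.
Lemma pliftYC c : pliftY c%:MP = (mren (@rshift m n) c)%:MP.
Proof. exact: mliftC. Qed.
Lemma pliftXX i : pliftX 'X_i = 'X_(lshift r2 i).
Proof. exact: mliftX. Qed.
Lemma pliftYX i : pliftY 'X_i = 'X_(rshift r1 i).
Proof. exact: mliftX. Qed.

Lemma prodpow_join K : prodpow fg K = pliftX (prodpow f K) * pliftY (prodpow g K).
Proof.
rewrite /prodpow pliftXC pliftYC -mpolyCM; congr (_%:MP).
rewrite big_split_ord exprMn !rmorphXn !rmorph_prod.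
by congr (_ ^+ K * _ ^+ K); apply: eq_bigr => i _; rewrite ?joinfam_lshift ?joinfam_rshift.
Qed.

Lemma emb_pliftX_tauX : emb12 (pliftX (tau1 'X)) = sumu C (m + n) r1 r2.
Proof.
rewrite tauX (rmorph_sum pliftX) (rmorph_sum emb12); apply: eq_bigr => i _.
exact: (etrans (congr1 emb12 (pliftXX i)) (embX _ _ _)).
Qed.

Lemma emb_pliftY_tauX : emb12 (pliftY (tau2 'X)) = sumv C (m + n) r1 r2.
Proof.
rewrite tauX (rmorph_sum pliftY) (rmorph_sum emb12); apply: eq_bigr => i _.
exact: (etrans (congr1 emb12 (pliftYX i)) (embX _ _ _)).
Qed.

Lemma pliftX_cst c : pliftX (cst m r1 c) = cst (m + n) (r1 + r2) c.
Proof. by apply: (etrans (pliftXC _)); rewrite mrenC. Qed.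
Lemma pliftY_cst c : pliftY (cst n r2 c) = cst (m + n) (r1 + r2) c.
Proof. by apply: (etrans (pliftYC _)); rewrite mrenC. Qed.

Lemma polyat_sumu b : polyat b (sumu C (m + n) r1 r2) = emb12 (pliftX (tau1 b)).
Proof.
rewrite -emb_pliftX_tauX.
apply: (@polyat_rmorph C (m + n) (r1 + r2) (emb12 \o (pliftX \o tau1)) b) => c.
exact: (congr1 emb12 (etrans (congr1 pliftX (tauC m r1 c)) (pliftX_cst c))).
Qed.


Lemma liftX_clear (u y : M1) h :
  emb u * h = emb y -> emb12 (pliftX u) * liftX h = emb12 (pliftX y).
Proof.
move=> e; apply: (etrans (congr1 (fun z => z * liftX h) (esym (liftX_emb n r2 u)))).
apply: (etrans (esym (liftXM _ _ _ _))).
exact: (etrans (congr1 liftX e) (liftX_emb n r2 y)).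
Qed.

Lemma liftY_clear (u y : M2) h :
  emb u * h = emb y -> emb12 (pliftY u) * liftY h = emb12 (pliftY y).
Proof.
move=> e; apply: (etrans (congr1 (fun z => z * liftY h) (esym (liftY_emb m r1 u)))).
apply: (etrans (esym (liftYM _ _ _ _))).
exact: (etrans (congr1 liftY e) (liftY_emb m r1 y)).
Qed.

(** All large [K] are allowed because the same [K] must also clear the cofactor of |u| - |v|. The
    power of the joined family is a product of lifts, so the two factors are cleared separately. *)
Lemma tensor_numerators (t : seq (fsmod C m r1 * fsmod C n r2)) :
  (forall p, p \in t -> fsspan f (fun a => \sum_i a i = 1) p.1 /\
                        fsspan g (fun a => \sum_i a i = 1) p.2) ->
  exists K0, forall K, (K0 <= K)%N -> exists t' : seq (M1 * M2),
    (forall y, y \in t' -> numerator f K y.1 /\ numerator g K y.2) /\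
    emb12 (prodpow fg K) * (\sum_(p <- t) liftX p.1 * liftY p.2) =
    emb12 (\sum_(y <- t') pliftX y.1 * pliftY y.2).
Proof.
elim: t => [|p t IH] tS.
  exists 0%N => K _; exists [::]; split=> //.
  by rewrite !big_nil mulr0 (rmorph0 emb12).
have [fp gp] := tS p (mem_head _ _).
have [K1 IH1] := IH (fun q qt => tS q (mem_behead (s := p :: t) qt)).
have [k1 c1] := cleared_fsspan f_neq0 fp.
have [k2 c2] := cleared_fsspan g_neq0 gp.
exists (k1 + k2 + K1)%N => K leK.
have le1 : (k1 <= K)%N := leq_trans (leq_trans (leq_addr k2 k1) (leq_addr K1 _)) leK.
have le2 : (k2 <= K)%N := leq_trans (leq_trans (leq_addl k1 k2) (leq_addr K1 _)) leK.
have [t' [t'S et']] := IH1 K (leq_trans (leq_addl _ _) leK).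
have := clearsW (K - k1) c1; rewrite (subnK le1) => -[y1 ey1].
have := clearsW (K - k2) c2; rewrite (subnK le2) => -[y2 ey2].
exists ((y1, y2) :: t'); split.
  move=> y; rewrite inE => /orP [/eqP ->|]; last exact: t'S.
  by split; [exists p.1 | exists p.2].
have e0 : emb12 (prodpow fg K) * (liftX p.1 * liftY p.2) = emb12 (pliftX y1 * pliftY y2).
  apply: (etrans (congr1 (fun u => u * (liftX p.1 * liftY p.2))
    (etrans (congr1 emb12 (prodpow_join K)) (embM _ _)))).
  apply: (etrans (mulrACA _ _ _ _)); apply: (etrans _ (esym (embM _ _))).
  exact: (congr2 *%R (liftX_clear ey1) (liftY_clear ey2)).
rewrite !big_cons mulrDr (rmorphD emb12); exact: (congr2 +%R e0 et').
Qed.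

Lemma product_annihilator_dvd (bI bJ c : {poly C}) (i0 : 'I_r1) (j0 : 'I_r2) p :
  isBSpoly f bI -> isBSpoly g bJ ->
  fsspan fg (fun a => \sum_(i < r1) a (lshift r2 i) = 1 /\
                      \sum_(j < r2) a (rshift r1 j) = 1) p ->
  eqmod_uv fg (polyat c (sumu C (m + n) r1 r2)) p ->
  bI * bJ %| c.
Proof.
move=> bIP bJP /fsspan_join_tensor_sum [t [tS ->]] [q [q_loc eq]].
have [K1 num] := tensor_numerators tS.
have [k2 c2] := cleared_mpoly joinfam_neq0 q_loc.
pose K := (K1 + k2)%N.
have [t' [t'S et']] := num K (leq_addr _ _).
have [Q eQ] : clears fg K q by exact: clearsW.
pose sX := [seq y.1 | y <- t']; pose sY := [seq y.2 | y <- t'].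
have sXP y : y \in sX -> numerator f K y by move=> /mapP [z /t'S [? _] ->].
have sYP y : y \in sY -> numerator g K y by move=> /mapP [z /t'S [_ ?] ->].
(* The functionals depend on the finite lists of numerators on which they must be integral, so they
   are chosen after [K] and [t']. *)
have [phi [dphi [phi_lin dphi0 phi_int phi_b]]] := isBSpoly_dual f_neq0 i0 bIP sXP.
have [psi [dpsi [psi_lin dpsi0 psi_int psi_b]]] := isBSpoly_dual g_neq0 j0 bJP sYP.
have eL : emb12 (pliftX (tau1 c * prodpow f K) * pliftY (prodpow g K)) =
    polyat c (sumu C (m + n) r1 r2) * emb12 (prodpow fg K).
  apply: (etrans _ (congr1 (fun z => z * emb12 (prodpow fg K)) (esym (polyat_sumu c)))).
  apply: (etrans _ (embM _ _)); apply: (congr1 emb12).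
  apply: (etrans (congr1 (fun z => z * pliftY (prodpow g K)) (rmorphM pliftX _ _))).
  apply: (etrans (esym (mulrA _ _ _))).
  exact: (congr1 (fun z => pliftX (tau1 c) * z) (esym (prodpow_join K))).
have eR : emb12 (\sum_(y <- t') pliftX y.1 * pliftY y.2 +
      (pliftX (tau1 'X) - pliftY (tau2 'X)) * Q) =
    emb12 (prodpow fg K) * (\sum_(p <- t) liftX p.1 * liftY p.2) +
    (sumu C (m + n) r1 r2 - sumv C (m + n) r1 r2) * (emb12 (prodpow fg K) * q).
  have eUV := etrans (rmorphB emb12 _ _)
    (congr2 (fun x y => x - y) emb_pliftX_tauX emb_pliftY_tauX).
  apply: (etrans (rmorphD emb12 _ _)); apply: (congr2 +%R (esym et')).
  exact: (etrans (embM _ _) (congr2 *%R eUV (esym eQ))).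
(* The congruence modulo |u| - |v|, cleared of denominators, is an identity of polynomials, to which
   [prodfun] applies. *)
have key : pliftX (tau1 c * prodpow f K) * pliftY (prodpow g K) =
    \sum_(y <- t') pliftX y.1 * pliftY y.2 +
    (pliftX (tau1 'X) - pliftY (tau2 'X)) * Q.
  apply: emb_inj; apply: (etrans eL); apply: (etrans _ (esym eR)).
  exact: clear_equation.
have [a int_sum] : exists a, prodfun phi psi (\sum_(y <- t') pliftX y.1 * pliftY y.2) = a%:F.
  have t'int y : y \in t' -> exists a, phi y.1 * psi y.2 = a%:F.
    move=> yt; have [a ea] := phi_int y.1 (map_f _ yt).
    have [b eb] := psi_int y.2 (map_f _ yt).
    by exists (a * b); rewrite ea eb tofracM.
  elim: (t') t'int => [|y l IH] lint; first by exists 0; rewrite big_nil prodfun0 tofrac0.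
  have [a ea] := lint y (mem_head _ _).
  have [b eb] := IH (fun z zl => lint z (mem_behead (s := y :: l) zl)).
  exists (a + b); rewrite big_cons prodfunD (prodfun_lift phi_lin psi_lin) tofracD.
  exact: (congr2 +%R ea eb).
have := congr1 (prodfun phi psi) key.
rewrite prodfunD int_sum (prodfun_tau_diff phi_lin psi_lin) addr0.
rewrite (prodfun_lift phi_lin psi_lin) (tau_functionalM phi_lin) => e.
(* Multiplying by b_I b_J turns the values at the two numerators of f^s and g^s into the constants
   [dphi] and [dpsi]. *)
have {}e : c * dphi%:P * dpsi%:P = bI * bJ * a.
  apply: tofrac_inj; rewrite !tofracM -phi_b -psi_b -e; ring.
have d0 : dphi * dpsi != 0 by rewrite mulf_neq0.
rewrite -(dvdpZr _ c d0); have -> : (dphi * dpsi) *: c = bI * bJ * a.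
  by rewrite -e -mul_polyC polyCM; ring.
exact: dvdp_mulr.
Qed.

Lemma product_annihilator (bI bJ : {poly C}) : annihilates f bI -> annihilates g bJ ->
  exists p : fsmod C (m + n) (r1 + r2),
    fsspan fg (fun a => \sum_(i < r1) a (lshift r2 i) = 1 /\
                        \sum_(j < r2) a (rshift r1 j) = 1) p /\
    eqmod_uv fg (polyat (bI * bJ) (sumu C (m + n) r1 r2)) p.
Proof.
move=> fI gJ; exists (liftX (emb (tau1 bI)) * liftY (emb (tau2 bJ))).
split; first exact: fsspan_join_mul.
have [w ew] : exists w, pliftX (tau1 bJ) - pliftY (tau2 bJ) =
    (pliftX (tau1 'X) - pliftY (tau2 'X)) * w.
  apply: (@rmorph_diff_factor C M12 (pliftX \o tau1) (pliftY \o tau2)) => c.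
  have e1 := etrans (congr1 pliftX (tauC m r1 c)) (pliftX_cst c).
  have e2 := etrans (congr1 pliftY (tauC n r2 c)) (pliftY_cst c).
  exact: (etrans e1 (esym e2)).
exists (emb12 (pliftX (tau1 bI) * w)); split.
  move=> e; exists ((pliftX (tau1 bI) * w)@_e), 0%N.
  by rewrite mcoeff_emb expr0 tofrac1 divr1.
have eUV := etrans (rmorphB emb12 _ _)
  (congr2 (fun x y => x - y) emb_pliftX_tauX emb_pliftY_tauX).
have eIJ := etrans (congr1 pliftX (rmorphM tau1 bI bJ)) (rmorphM pliftX _ _).
have eIJ' := etrans (polyat_sumu (bI * bJ)) (congr1 emb12 eIJ).
have eP := congr2 *%R (liftX_emb n r2 (tau1 bI)) (liftY_emb m r1 (tau2 bJ)).
apply: (etrans (congr2 (fun x y => x - y) eIJ' eP)).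
apply: (etrans (congr1 (fun z => _ - z) (esym (embM _ _)))).
apply: (etrans (esym (rmorphB emb12 _ _))).
apply: (etrans (congr1 emb12 (factor_difference (pliftX (tau1 bI)) ew))).
apply: (etrans (embM _ _)).
exact: (congr1 (fun z => z * emb12 (pliftX (tau1 bI) * w)) eUV).
Qed.

End ProductBSpoly.

(** This supplies the variable that the substitution [sigma] eliminates. *)
Lemma generators_gt0 (C : fieldType) m r (f : 'I_r -> {mpoly C[m]}) I :
  (exists h, I h /\ h <> 0) -> generates f I -> (0 < r)%N.
Proof.
case: r f => [|r] f [h [Ih h0]] gen //.
by have [c eh] := (gen h).1 Ih; case: h0; rewrite eh big_ord0.
Qed.


Unset Implicit Arguments.
Set Strict Implicit.
Set Printing Implicit Defensive.

Theorem proposition3p5 (R : realType) (m n r1 r2 : nat)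
    (I : {mpoly R[i][m]} -> Prop) (J : {mpoly R[i][n]} -> Prop)
    (f : 'I_r1 -> {mpoly R[i][m]}) (g : 'I_r2 -> {mpoly R[i][n]})
    (I_neq0 : exists h, I h /\ h <> 0) (J_neq0 : exists h, J h /\ h <> 0)
    (f_neq0 : forall i, f i <> 0) (g_neq0 : forall j, g j <> 0)
    (f_gen : generates f I) (g_gen : generates g J)
    (bI bJ : {poly R[i]}) :
  isBSpoly f bI -> isBSpoly g bJ ->
  forall b : {poly R[i]}, isprodBSpoly f g b <-> b = bI * bJ.
Proof.
move=> bIP bJP b.
have i0 := Ordinal (generators_gt0 I_neq0 f_gen).
have j0 := Ordinal (generators_gt0 J_neq0 g_gen).
have [mI aI _] := bIP; have [mJ aJ _] := bJP.
rewrite !polyat_tau in aI aJ.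
have aIJ := product_annihilator aI aJ.
have mIJ : bI * bJ \is monic by rewrite monicMr.
have dvd c p := @product_annihilator_dvd _ _ _ _ _ f g f_neq0 g_neq0
  bI bJ c i0 j0 p bIP bJP.
split=> [[mb [p [fp ep]] b_min]|->].
  (* Divisibility bounds the size of [b] from below and minimality from above; monic associates are
     equal. *)
  have b_dvd := dvd _ _ fp ep; have le_b := b_min _ mIJ aIJ.
  apply/eqP; rewrite eq_sym -eqp_monic // -dvdp_size_eqp // eqn_leq le_b andbT.
  by rewrite dvdp_leq // monic_neq0.
split=> // c mc [p [fp ep]].
by rewrite dvdp_leq ?monic_neq0 //; exact: dvd fp ep.
Qed.
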